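(* Let $\rho=\lambda-(\sup(p_0)-\inf(p_0))$ and assume that $$\mathbf{Q_1}=\sup_{i\in F^*}\sum_{j\in F^*,\,j\ne i}Q_{i,j}<+\infty\quad\text{and}\quad \mathbf{p}=\sup_{i\in F^*}p_0(i)<+\infty.$$ Let $g,h:E\to\mathbb{R}$ be two $1$-Lipschitz mappings on $(E,d_1)$, i.e. $|g(\eta)-g(\eta')|\le d_1(\eta,\eta')$ and $|h(\eta)-h(\eta')|\le d_1(\eta,\eta')$ for every $\eta,\eta'\in E$. Then for all $t\ge0$ and $\eta\in E$, $$\left|\mathrm{Cov}_\eta(g(\eta_t),h(\eta_t))\right|\le\frac{1-e^{-2\rho t}}{2\rho}\left(N\mathbf{Q_1}+\mathbf{p}\frac{N^2}{N-1}\right),$$ with the convention $(1-e^{-2\rho t})\rho^{-1}=2t$ when $\rho=0$.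
   Context: $F^*$ is a (finite or infinite) countable discrete set, and $(Q_{i,j})_{i,j\in F^*}$ is the transition rate matrix of an irreducible, positive recurrent continuous-time Markov process on $F^*$. The function $p_0:F^*\to[0,\infty)$ (death rate) is not identically zero; $\sup(p_0),\inf(p_0)$ are taken over $F^*$. The parameter $\lambda$ is $$\lambda=\inf_{i,i'\in F^*,\,i\ne i'}\Big(Q_{i,i'}+Q_{i',i}+\sum_{j\ne i,i'}Q_{i,j}\wedge Q_{i',j}\Big).$$ $N\ge2$ is an integer, $E=\{\eta:F^*\to\mathbb{N}:\sum_{i\in F^*}\eta(i)=N\}$, and $d_1(\eta,\eta')=\frac12\sum_{j\in F^*}|\eta(j)-\eta'(j)|$. $T_{i\to j}\eta$ is obtained from $\eta$ by decreasing $\eta(i)$ by 1 and increasing $\eta(j)$ by 1 (when $\eta(i)\ne0$). The Fleming-Viot process $(\eta_t)_{t\ge0}$ with $N$ particles is the Markov process on $E$ with generator $$\mathcal{L}f(\eta)=\sum_{i\in F^*}\eta(i)\sum_{j\in F^*}\big(f(T_{i\to j}\eta)-f(\eta)\big)\Big(Q_{i,j}+p_0(i)\frac{\eta(j)}{N-1}\Big).$$ $\mathbb{E}_\eta$ denotes expectation given $\eta_0=\eta$, and $\mathrm{Cov}_\eta(X,Y)=\mathbb{E}_\eta[XY]-\mathbb{E}_\eta[X]\mathbb{E}_\eta[Y]$. *)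

(* Defs.v *)
From HB Require Import structures.
From mathcomp Require Import all_boot all_order all_algebra finmap.
From mathcomp Require Import all_classical all_reals all_analysis.

Set Implicit Arguments.
Unset Strict Implicit.
Unset Printing Implicit Defensive.
Import Order.TTheory GRing.Theory Num.Theory.
Import numFieldNormedType.Exports.
Local Open Scope classical_set_scope.
Local Open Scope ring_scope.

(* Sum of an absolutely summable real family. *)
Definition rsum (R : realType) (I : choiceType) (f : I -> R) : R :=
  fine (\esum_(j in [set: I]) (f^\+ j)%:E) -
  fine (\esum_(j in [set: I]) (f^\- j)%:E).

(* Continuous-time Markov chains on a countable state space.  [P x] is the law
   of the chain started at [x]; only the times [0 <= t] of [X] are relevant. *)
Section markov_process.
Context (R : realType) (S : countType) (d : measure_display)
  (T : measurableType d).
Variables (P : S -> probability T R) (X : R -> T -> S).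

(* Event that the chain is at [z k] at each time [u k]. *)
Definition visits (n : nat) (u : 'I_n -> R) (z : 'I_n -> S) : set T :=
  [set w | forall k, X (u k) w = z k].

Definition markov_property : Prop :=
  forall (x : S) (n : nat) (u : 'I_n -> R) (z : 'I_n -> S) (s h : R) (y y' : S),
    (forall k, 0 <= u k <= s) -> 0 <= s -> 0 <= h ->
    (P x (visits u z `&` [set w | X s w = y] `&` [set w | X (s + h) w = y']) =
     P x (visits u z `&` [set w | X s w = y]) * P y [set w | X h w = y'])%E.

(* [L] gives the derivative at 0 of the semigroup on bounded functions. *)
Definition has_generator (L : (S -> R) -> (S -> R)) : Prop :=
  forall (f : S -> R) (x : S), (exists M : R, forall y, `|f y| <= M) ->
    (fun h : R => (fine 'E_(P x)[fun w => f (X h w)] - f x) / h) @ 0^'+ --> L f x.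

Record markov_process (L : (S -> R) -> (S -> R)) : Prop := MarkovProcess {
  mp_measurable : forall t, 0 <= t -> forall A : set S, measurable (X t @^-1` A);
  mp_start : forall x, P x [set w | X 0 w = x] = 1%E;
  mp_markov : markov_property;
  mp_generator : has_generator L }.

Definition right_continuous_paths : Prop :=
  forall (w : T) (t : R), 0 <= t ->
    exists2 e : R, 0 < e & forall s, t <= s < t + e -> X s w = X t w.

Definition irreducible_process : Prop :=
  forall x y : S, exists2 t : R, 0 <= t & (0 < P x [set w | X t w = y])%E.

Definition first_jump_time (w : T) : \bar R :=
  ereal_inf [set t%:E | t in [set t : R | 0 <= t /\ X t w <> X 0 w]].

Definition return_time (x : S) (w : T) : \bar R :=
  ereal_inf [set t%:E | t in
    [set t : R | [/\ 0 <= t, (first_jump_time w <= t%:E)%E & X t w = x]]].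

(* The first alternative only matters for absorbing states: an irreducible
   chain has one exactly when its state space is a singleton. *)
Definition positive_recurrent_process (Q : S -> S -> R) : Prop :=
  forall x : S, Q x x = 0 \/ (\int[P x]_w return_time x w < +oo)%E.

End markov_process.

Definition transition_rate_matrix (R : realType) (F : countType)
    (Q : F -> F -> R) : Prop :=
  (forall i j, i != j -> 0 <= Q i j) /\
  (forall i, \esum_(j in [set j | j != i]) (Q i j)%:E = (- Q i i)%:E).

Definition rate_generator (R : realType) (F : countType) (Q : F -> F -> R)
    (f : F -> R) (i : F) : R :=
  rsum (fun j => Q i j * (f j - f i)).

Definition irreducible_positive_recurrent (R : realType) (F : countType)
    (Q : F -> F -> R) : Prop :=
  exists (d : measure_display) (T : measurableType d)
    (P : F -> probability T R) (X : R -> T -> F),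
    [/\ markov_process P X (rate_generator Q), right_continuous_paths X,
        irreducible_process P X & positive_recurrent_process P X Q].

(* Configurations of [N] particles on [F]. *)
Record config (F : countType) (N : nat) := Config {
  occupation :> {fsfun F -> nat with 0%N};
  _ : (\sum_(i <- finsupp occupation) occupation i)%N == N }.

Section config.
Context (F : countType) (N : nat).

HB.instance Definition _ := [isSub for @occupation F N].
HB.instance Definition _ := [Countable of config F N by <:].

Definition move_raw (i j : F) (eta : config F N) : {fsfun F -> nat with 0%N} :=
  [fsfun k in (j |` finsupp eta)%fset => (eta k - (k == i) + (k == j))%N].

(* When [eta i = 0] there is no particle to move, [move_raw] has [N + 1]
   particles and [insubd] returns [eta]; see [moveE] for the other case. *)
Definition move (i j : F) (eta : config F N) : config F N :=
  insubd eta (move_raw i j eta).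

Lemma move_rawE (i j : F) (eta : config F N) (k : F) :
  move_raw i j eta k = (eta k - (k == i) + (k == j))%N.
Proof.
rewrite fsfun_fun !inE mem_finsupp; case: eqVneq => //= _.
by case: eqVneq => //= ->.
Qed.

Lemma moveE (i j : F) (eta : config F N) (k : F) : eta i != 0%N ->
  move i j eta k = (eta k - (k == i) + (k == j))%N.
Proof.
move=> eta_i; rewrite /move -move_rawE -/(val _) val_insubd ifT//=.
set S := (j |` finsupp eta)%fset.
have iS : i \in S by rewrite !inE mem_finsupp eta_i orbT.
have jS : j \in S by rewrite !inE eqxx.
have sumS (f : {fsfun F -> nat with 0%N}) :
    (forall x, x \notin S -> f x = 0%N) ->
    (\sum_(k <- finsupp f) f k = \sum_(k <- S) f k)%N.
  move=> f0; apply: big_fset_incl => [|x _ /fsfun_dflt//].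
  apply/fsubsetP => x; rewrite mem_finsupp; apply: contraR => /f0 ->.
  by rewrite eqxx.
have eta0 x : x \notin S -> eta x = 0%N.
  by rewrite !inE negb_or => /andP[_ /fsfun_dflt].
have eta_sum : (\sum_(k <- S) eta k)%N = N.
  by rewrite -sumS//; exact/eqP/(valP eta).
have one l : l \in S -> (\sum_(k <- S) (k == l) = 1)%N.
  move=> lS; rewrite (big_fsetD1 l)//= eqxx big1_fset// => x.
  by rewrite !inE => /andP[/negbTE ->].
rewrite sumS; last first.
  move=> x xS; rewrite move_rawE eta0// sub0n.
  by case: eqVneq xS => // ->; rewrite jS.
under eq_bigr do rewrite move_rawE.
rewrite big_split/= one// -[X in (_ + X)%N == _](one i)// -big_split/=.
rewrite -[X in _ == X]eta_sum; apply/eqP; apply: eq_bigr => x _.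
by rewrite subnK//; case: eqVneq => // ->; rewrite lt0n.
Qed.

End config.

Section fleming_viot.
Context (R : realType) (F : countType).

(* The infimum is in [\bar R]: it is [+oo] when [F] is a singleton. *)
Definition lambda (Q : F -> F -> R) : \bar R :=
  ereal_inf [set ((Q ii.1 ii.2)%:E + (Q ii.2 ii.1)%:E +
      \esum_(j in [set j | j != ii.1 /\ j != ii.2])
        (Num.min (Q ii.1 j) (Q ii.2 j))%:E)%E
    | ii in [set ii : F * F | ii.1 != ii.2]].

Definition sup_rate (p0 : F -> R) : \bar R :=
  ereal_sup [set (p0 i)%:E | i in [set: F]].

Definition inf_rate (p0 : F -> R) : \bar R :=
  ereal_inf [set (p0 i)%:E | i in [set: F]].

Definition rho (Q : F -> F -> R) (p0 : F -> R) : \bar R :=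
  (lambda Q - (sup_rate p0 - inf_rate p0))%E.

Definition sup_jump_rate (Q : F -> F -> R) : \bar R :=
  ereal_sup [set \esum_(j in [set j | j != i]) (Q i j)%:E | i in [set: F]].

Definition d1 (N : nat) (eta eta' : config F N) : R :=
  2^-1 * \sum_(j \in [set: F]) `|(eta j)%:R - (eta' j)%:R : R|.

Definition lipschitz1 (N : nat) (g : config F N -> R) : Prop :=
  forall eta eta' : config F N, `|g eta - g eta'| <= d1 eta eta'.

Definition fv_generator (N : nat) (Q : F -> F -> R) (p0 : F -> R)
    (f : config F N -> R) (eta : config F N) : R :=
  \sum_(i \in [set: F]) (eta i)%:R *
    rsum (fun j => (f (move i j eta) - f eta) *
                   (Q i j + p0 i * ((eta j)%:R / (N%:R - 1)))).

End fleming_viot.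

Definition Cov (R : realType) (d : measure_display) (T : measurableType d)
    (P : probability T R) (Y Z : T -> R) : \bar R :=
  ('E_P[fun w => (Y w * Z w)%R] - 'E_P[Y] * 'E_P[Z])%E.

(* [(1 - exp (- 2 r t)) / (2 r)], extended by continuity at [r = 0]; for
   [r = +oo] the formula evaluates to 0. *)
Definition decay_factor (R : realType) (r : \bar R) (t : R) : \bar R :=
  (if r == 0 then t%:E
   else (1 - expeR (- (2%:E * r * t%:E))) / (2%:E * r))%E.

(* Main.v *)
Require Import Defs.
From mathcomp Require Import all_boot all_order all_algebra finmap.
From mathcomp Require Import all_classical all_reals all_analysis.
From mathcomp Require Import measurable_realfun zify ring lra.

(* The infinitesimal covariance of [f] and [k] at [x] (the carre du champ) is at
   most (N Q1 + p N^2/(N-1)) Lip(f) Lip(k), since every jump has d1-length at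
   most 1, and the semigroup multiplies Lipschitz constants by exp(-rho t).
   Conditioning on the state after a time step [e],
     Cov_{e+s}(g,h) = P_e (Cov_s(g,h)) + Cov_e(P_s g, P_s h),
   so the covariances of the successive steps add up to a Riemann sum of
   exp(-2 rho s) on [0,t].

   No coupled process is constructed.  As the jump rates are bounded,
   P_e f = f + e L f + O(e^2) uniformly in the starting point, which follows from
   the pointwise derivative at 0 by telescoping; the contraction is thus a
   statement about [f + e L f], and it is proved by comparing [L f] at two
   configurations differing by one move, along the optimal coupling of their
   jumps.  Lipschitz constants can therefore be taken along single moves. *)

Set Implicit Arguments.
Unset Strict Implicit.
Unset Printing Implicit Defensive.
Import Order.TTheory GRing.Theory Num.Theory.
Import numFieldNormedType.Exports.
Local Open Scope classical_set_scope.
Local Open Scope ring_scope.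

(** * Markov semigroups with bounded rates *)

Definition bounded_by (R : realType) (S : Type) (M : R) (f : S -> R) : Prop :=
  forall x, `|f x| <= M.

Section bounded_by.
Context (R : realType) (S : Type).
Implicit Types (f g : S -> R) (M : R).

Lemma bounded_by_cst c : bounded_by `|c| (fun _ : S => c : R).
Proof. by move=> x. Qed.

Lemma bounded_byD M1 M2 f g : bounded_by M1 f -> bounded_by M2 g ->
  bounded_by (M1 + M2) (fun x => f x + g x).
Proof. by move=> bf bg x; rewrite (le_trans (ler_normD _ _))// lerD. Qed.

Lemma bounded_byB M1 M2 f g : bounded_by M1 f -> bounded_by M2 g ->
  bounded_by (M1 + M2) (fun x => f x - g x).
Proof. by move=> bf bg x; rewrite (le_trans (ler_normB _ _))// lerD. Qed.

Lemma bounded_byM M1 M2 f g : bounded_by M1 f -> bounded_by M2 g ->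
  bounded_by (M1 * M2) (fun x => f x * g x).
Proof. by move=> bf bg x; rewrite normrM ler_pM. Qed.

Lemma bounded_byZ c M f : bounded_by M f ->
  bounded_by (`|c| * M) (fun x => c * f x).
Proof. by move=> bf x; rewrite normrM ler_pM. Qed.

End bounded_by.

(** Passage to the limit of zero step size, for bounds obtained by cutting the interval of length
    [t] into [n.+1] equal steps. *)
Lemma le_cvg_step (R : realType) (F : R -> R) (a t : R) :
  {for 0, continuous F} -> (\forall n \near \oo, a <= F (t / n.+1%:R)) ->
  a <= F 0.
Proof.
move=> F0 aF.
have t0 : (t / n.+1%:R : R) @[n --> \oo] --> (0 : R).
  by rewrite -(mulr0 t); apply: cvgMl_tmp; exact: (@cvg_harmonic R).
have cF : F (t / n.+1%:R) @[n --> \oo] --> F 0 by exact: (cvg_comp _ _ t0 F0).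
by apply: (cvgr_to_ge cF).
Qed.

Section damping.
Context (R : realType) (rho : R).
Implicit Types (s e : R).

(** The integral of exp(-2 rho u) for u in [0, s], which for [rho = 0] is [s]. *)
Definition damping s : R :=
  if rho == 0 then s else (1 - expR (- (2 * rho * s))) / (2 * rho).

Lemma damping0 : damping 0 = 0.
Proof. by rewrite /damping mulr0 oppr0 expR0 subrr mul0r if_same. Qed.

(** Splitting of the integral at [s], the second piece being translated back to 0. *)
Lemma dampingD s e :
  damping (s + e) = damping s + expR (- (rho * s)) ^+ 2 * damping e.
Proof.
rewrite /damping; case: eqVneq => [->|r0].
  by rewrite mul0r oppr0 expR0 expr1n mul1r.
rewrite (_ : expR _ ^+ 2 = expR (- (2 * rho * s))); last first.
  by rewrite expr2 -expRD; congr expR; ring.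
rewrite (_ : - (2 * rho * (s + e)) = - (2 * rho * s) + - (2 * rho * e));
  last by ring.
by rewrite expRD; field.
Qed.

(** The integrand exp(-2 rho u) is at least exp(-2 |rho| e) on [0, e]. In closed form this reduces
    to exp(u) >= 1 + u. It turns the covariance of one step, of order [e], into an increment of
    [damping]. *)
Lemma le_damping e : 0 <= e -> e <= expR (2 * `|rho| * e) * damping e.
Proof.
move=> e0; rewrite /damping; case: eqVneq => [->|r0].
  by rewrite normr0 mulr0 mul0r expR0 mul1r.
have := expR_ge1Dx (2 * `|rho| * e); case: (ltrgt0P rho) r0 => // rho0 _ ge1.
  rewrite mulrA ler_pdivlMr ?mulr_gt0// mulrBr mulr1 -expRD subrr expR0; lra.
rewrite mulrA ler_ndivlMr ?pmulr_rlt0//; move: ge1.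
set E := expR _; rewrite (_ : - (2 * rho * e) = 2 * - rho * e); last by ring.
by rewrite -/E => ge1; have : 0 <= - (rho * e) by [nra]; nra.
Qed.

End damping.

(** The laws concern bounded functions only, because the integral of an arbitrary function may be a
    default value. *)
Record markov_semigroup (R : realType) (S : Type)
    (Pt : R -> (S -> R) -> S -> R) : Prop := MarkovSemigroup {
  msL : forall t M M' (f g : S -> R) a x, 0 <= t -> bounded_by M f ->
    bounded_by M' g ->
    Pt t (fun y => a * f y + g y) x = a * Pt t f x + Pt t g x;
  ms_cst : forall t c x, 0 <= t -> Pt t (fun=> c) x = c;
  ms_ge0 : forall t M f x, 0 <= t -> bounded_by M f -> (forall y, 0 <= f y) ->
    0 <= Pt t f x;
  ms0 : forall M f x, bounded_by M f -> Pt 0 f x = f x;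
  msD : forall s t M f x, 0 <= s -> 0 <= t -> bounded_by M f ->
    Pt (s + t) f x = Pt s (Pt t f) x }.

Section semigroup.
Context (R : realType) (S : eqType).
Variable (Pt : R -> (S -> R) -> S -> R).
Hypothesis msPt : markov_semigroup Pt.
Implicit Types (f g : S -> R) (M t s : R).

Lemma sgB t M M' f g x : 0 <= t -> bounded_by M f -> bounded_by M' g ->
  Pt t (fun y => f y - g y) x = Pt t f x - Pt t g x.
Proof.
move=> t0 bf bg; rewrite (_ : (fun y => _) = fun y => -1 * g y + f y).
  by rewrite (msL msPt _ _ t0 bg bf) mulN1r addrC.
by apply/funext => y; rewrite mulN1r addrC.
Qed.

Lemma sgZ t M f a x : 0 <= t -> bounded_by M f ->
  Pt t (fun y => a * f y) x = a * Pt t f x.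
Proof.
move=> t0 bf; rewrite (_ : (fun y => _) = fun y => a * f y + 0).
  by rewrite (msL msPt _ _ t0 bf (bounded_by_cst 0)) (ms_cst msPt)// addr0.
by apply/funext => y; rewrite addr0.
Qed.

Lemma sg_le t M M' f g x : 0 <= t -> bounded_by M f -> bounded_by M' g ->
  (forall y, f y <= g y) -> Pt t f x <= Pt t g x.
Proof.
move=> t0 bf bg fg; rewrite -subr_ge0 -(sgB _ t0 bg bf).
by apply: (ms_ge0 msPt _ t0 (bounded_byB bg bf)) => y; rewrite subr_ge0.
Qed.

Lemma sg_norm t M M' f g x : 0 <= t -> bounded_by M f -> bounded_by M' g ->
  (forall y, `|f y| <= g y) -> `|Pt t f x| <= Pt t g x.
Proof.
move=> t0 bf bg fg; rewrite ler_norml; apply/andP; split; last first.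
  by apply: (sg_le _ t0 bf bg) => y; exact: le_trans (ler_norm _) (fg y).
rewrite -mulN1r -(sgZ _ _ t0 bg).
apply: (sg_le _ t0 (bounded_byZ _ bg) bf) => y.
by rewrite mulN1r lerNl (le_trans _ (fg y))// -normrN ler_norm.
Qed.

Lemma sg_bounded t M f : 0 <= t -> bounded_by M f -> bounded_by M (Pt t f).
Proof.
move=> t0 bf x; rewrite -[leRHS](ms_cst msPt M x t0).
exact: (sg_norm _ t0 bf (bounded_by_cst M) bf).
Qed.

Lemma sg_subr t M f x c : 0 <= t -> bounded_by M f ->
  Pt t (fun y => f y - c) x = Pt t f x - c.
Proof.
by move=> t0 bf; rewrite (sgB _ t0 bf (bounded_by_cst c)) (ms_cst msPt).
Qed.

(** * Short-time expansion of a semigroup with bounded rates *)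

Section generator.
Variables (L : (S -> R) -> S -> R) (nb : S -> S -> Prop) (C : R).
Hypothesis L_gen : forall M f x, bounded_by M f ->
  (fun h => (Pt h f x - f x) / h) @ 0^'+ --> L f x.
Hypothesis C_ge0 : 0 <= C.
(** This encodes that jumps from [x] lead to [nb]-neighbours and have total rate at most [C],
    without mentioning the rates themselves. Applied to [off x] it bounds the exit rate, applied to
    a product of centred functions it bounds the carre du champ. *)
Hypothesis L_local : forall M f x (c : R), bounded_by M f -> 0 <= c -> f x = 0 ->
  (forall y, nb x y -> `|f y| <= c) -> `|L f x| <= C * c.

Let off (x y : S) : R := (y != x)%:R.

Let off_bounded x : bounded_by 1 (off x).
Proof. by move=> y; rewrite /off; case: eqP; rewrite ?normr0 ?normr1. Qed.

Let off_le1 t x : 0 <= t -> 0 <= Pt t (off x) x <= 1.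
Proof.
move=> t0; have /= := sg_bounded t0 (off_bounded x) x.
have := ms_ge0 msPt x t0 (off_bounded x) => /(_ _)/wrap[|->/=].
  by move=> y; rewrite /off.
exact: le_trans (ler_norm _).
Qed.

(* The holding probability [1 - Pt t (off x) x] is supermultiplicative in [t]. *)
Let off_iter (h : R) x n : 0 <= h ->
  (1 - Pt h (off x) x) ^+ n <= 1 - Pt (n%:R * h) (off x) x.
Proof.
move=> h0; elim: n => [|n IH].
  by rewrite expr0 mul0r (ms0 msPt _ (off_bounded x)) /off eqxx subr0.
have nh0 : 0 <= n%:R * h by rewrite mulr_ge0.
have /andP[p0 p1] := off_le1 x nh0; have /andP[q0 q1] := off_le1 x h0.
rewrite exprS (_ : n.+1%:R * h = h + n%:R * h); last by rewrite -natr1; ring.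
rewrite (msD msPt x h0 nh0 (off_bounded x)).
apply: (@le_trans _ _ ((1 - Pt h (off x) x) * (1 - Pt (n%:R * h) (off x) x))).
  by rewrite ler_wpM2l// subr_ge0.
set p := Pt (n%:R * h) (off x) x.
(* The function [Pt (n%:R * h) (off x)] is at most 1 everywhere and equals [p] at [x], so it lies
   below [(1 - p) * off x y + p]. *)
have bo := bounded_byD (bounded_byZ (1 - p) (off_bounded x)) (bounded_by_cst p).
have : Pt h (Pt (n%:R * h) (off x)) x <= (1 - p) * Pt h (off x) x + p.
  have := @sg_le h _ _ _ _ x h0 (sg_bounded nh0 (off_bounded x)) bo.
  rewrite (msL msPt _ _ h0 (off_bounded x) (bounded_by_cst _)) (ms_cst msPt)//.
  apply=> y; rewrite /off; case: eqP => [->|_]; first by rewrite mulr0 add0r.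
  rewrite mulr1 subrK.
  exact: le_trans (ler_norm _) (sg_bounded nh0 (off_bounded x) y).
by move=> ?; lra.
Qed.

(** Bernoulli's inequality. *)
Lemma onem_le_expr (u : R) n : 0 <= u <= 1 -> 1 - n%:R * u <= (1 - u) ^+ n.
Proof.
move=> /andP[u0 u1]; elim: n => [|n IH]; first by rewrite mul0r subr0 expr0.
rewrite exprS (@le_trans _ _ ((1 - u) * (1 - n%:R * u)))//.
  have : 0 <= n%:R * u * u by rewrite !mulr_ge0.
  by rewrite -natr1 => ?; nra.
by rewrite ler_wpM2l// subr_ge0.
Qed.

Lemma cvg_at_right_seq (F : R -> R) (l h e : R) : 0 < h -> 0 < e ->
  F @ 0^'+ --> l -> \forall n \near \oo, `|F (h / n%:R) - l| < e.
Proof.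
move=> h0 e0 /cvgrPdist_lt/(_ _ e0)[d /= d0 dF].
near=> n; have n0 : (0 < n)%N by near: n; exists 1%N.
rewrite distrC; apply: dF => /=; last by rewrite divr_gt0// ltr0n.
rewrite sub0r normrN gtr0_norm ?divr_gt0 ?ltr0n// ltr_pdivrMr ?ltr0n//.
by rewrite mulrC -ltr_pdivrMr//; near: n; exact: nbhs_infty_gtr.
Unshelve. all: end_near. Qed.

(** The derivative at 0 controls the exit probability for one small step [h = t / n.+1].
    Supermultiplicativity of the holding probability and Bernoulli's inequality carry this over to
    [n.+1] steps. Only the derivative at the point [x] enters, yet the resulting bound is uniform in
    [x]. *)
Lemma sg_off t x : 0 <= t -> Pt t (off x) x <= C * t.
Proof.
rewrite le_eqVlt => /predU1P[<-|t0].
  by rewrite (ms0 msPt _ (off_bounded x)) /off eqxx mulr0.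
apply/ler_addgt0Pr => e e0.
(* A rate error of [e / t] adds up to [e] over total time [t]. *)
have et : 0 < e / t by rewrite divr_gt0.
have [n _ /(_ n.+1 (leqnSn _))] :=
  cvg_at_right_seq t0 et (L_gen (x:=x) (off_bounded x)).
set h := t / _; have h0 : 0 < h by rewrite divr_gt0.
have nh : n.+1%:R * h = t by rewrite /h mulrC divfK.
rewrite /= [X in X / h](_ : _ = Pt h (off x) x); last first.
  by rewrite /off eqxx subr0.
have : `|L (off x) x| <= C.
  rewrite -[leRHS]mulr1; apply: (L_local (off_bounded x)) => //.
  - by rewrite /off eqxx.
  - by move=> y _; exact: off_bounded.
move=> /ler_normlP[_ LC]; rewrite ltr_distl => /andP[_ Ph].
have {}Ph : Pt h (off x) x <= (C + e / t) * h.
  rewrite -ler_pdivrMr//; apply: le_trans (ltW Ph) _; lra.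
have /(onem_le_expr n.+1) := off_le1 x (ltW h0).
move/le_trans/(_ (off_iter _ _ (ltW h0))); rewrite nh => offt.
suff : n.+1%:R * Pt h (off x) x <= C * t + e by lra.
apply: le_trans (ler_wpM2l _ Ph) _; first by [].
by rewrite mulrCA nh mulrDl divfK// gt_eqF.
Qed.

(** The difference between [f] and its value at [x] is dominated by [2 * M * off x], so the exit
    probability bounds it. *)
Lemma sg_lip_time t M f x : 0 <= t -> bounded_by M f ->
  `|Pt t f x - f x| <= 2 * M * C * t.
Proof.
move=> t0 bf; have M0 : 0 <= M by apply: le_trans (bf x).
rewrite -(sg_subr _ _ t0 bf).
apply: (@le_trans _ _ (Pt t (fun y => (2 * M) * off x y) x)).
  apply: (sg_norm _ t0 (bounded_byB bf (bounded_by_cst _))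
    (bounded_byZ _ (off_bounded x))) => y.
  rewrite /off; case: eqP => [->|_]; first by rewrite subrr normr0 mulr0.
  by rewrite mulr1 (le_trans (ler_normB _ _))// mulr2n mulrDl !mul1r lerD.
rewrite (sgZ _ _ t0 (off_bounded x)) -[leRHS]mulrA.
by rewrite ler_wpM2l ?mulr_ge0// sg_off.
Qed.

(** With [D = Pt h f - f], the increment [Pt t f - f] telescopes into the sum of [Pt (k%:R * h) D].
    Moving each term back to [D x] costs a second-order amount by [sg_lip_time], and [D x] is close
    to [h * L f x] by the derivative at [x] alone. Hence no uniformity of the limit is assumed. *)
Lemma sg_second_order t M f x : 0 <= t -> bounded_by M f ->
  `|Pt t f x - f x - t * L f x| <= 4 * C ^+ 2 * M * t ^+ 2.
Proof.
rewrite le_eqVlt => /predU1P[<-|t0] bf.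
  by rewrite (ms0 msPt _ bf) subrr mul0r subr0 normr0 expr0n mulr0.
apply/ler_addgt0Pr => e e0.
have et : 0 < e / t by rewrite divr_gt0.
have [n _ /(_ n.+1 (leqnSn _))] := cvg_at_right_seq t0 et (L_gen (x:=x) bf).
set h := t / _; have h0 : 0 < h by rewrite divr_gt0.
have nh : n.+1%:R * h = t by rewrite /h mulrC divfK.
set D := fun y => Pt h f y - f y => /= /ltW Ld.
have bD : bounded_by (2 * M * C * h) D.
  by move=> y; apply: sg_lip_time => //; exact: ltW.
have -> : Pt t f x - f x = \sum_(k < n.+1) Pt (k%:R * h) D x.
  have kh0 k : 0 <= k%:R * h by rewrite mulr_ge0// ltW.
  rewrite -nh; elim: n.+1 => [|k IH].
    by rewrite big_ord0 mul0r (ms0 msPt _ bf) subrr.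
  rewrite big_ord_recr/= -IH /D (sgB _ _ (sg_bounded (ltW h0) bf) bf)//.
  by rewrite -(msD msPt _ _ (ltW h0) bf)// -natr1 mulrDl mul1r; ring.
have -> : t * L f x = \sum_(k < n.+1) h * L f x.
  by rewrite sumr_const card_ord -[RHS]mulr_natl mulrA nh.
rewrite -sumrB.
have M0 : 0 <= M by apply: le_trans (bf x).
have step (k : 'I_n.+1) : `|Pt (k%:R * h) D x - h * L f x| <=
    4 * C ^+ 2 * M * t * h + e / n.+1%:R.
  rewrite (_ : _ - _ = (Pt (k%:R * h) D x - D x) + (D x - h * L f x));
    last by ring.
  apply: le_trans (ler_normD _ _) _; apply: lerD.
    (* As [D] is bounded by [2 * M * C * h], [sg_lip_time] applied to [D] gives the constant 4 = 2 *
       2. *)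
    have kh0 : 0 <= k%:R * h by rewrite mulr_ge0// ltW.
    apply: le_trans (sg_lip_time _ kh0 bD) _.
    rewrite (_ : 2 * _ * _ * _ = 4 * C ^+ 2 * M * h * (k%:R * h)); last by ring.
    rewrite (_ : 4 * C ^+ 2 * M * t * h = 4 * C ^+ 2 * M * h * t); last by ring.
    apply: ler_wpM2l; first by rewrite !mulr_ge0 ?exprn_ge0// ltW.
    by rewrite -[leRHS]nh ler_wpM2r ?(ltW h0)// ler_nat ltnW.
  rewrite (_ : D x - h * L f x = h * (D x / h - L f x)); last first.
    by field; rewrite gt_eqF.
  rewrite normrM gtr0_norm//; apply: le_trans (ler_wpM2l (ltW h0) Ld) _.
  by rewrite mulrC /h mulrA divfK// gt_eqF.
apply: le_trans (ler_norm_sum _ _ _) _.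
apply: le_trans (ler_sum _ (fun k _ => step k)) _.
rewrite sumr_const card_ord -[leLHS]mulr_natl mulrDr.
rewrite [_ * (e / _)]mulrC divfK ?pnatr_eq0//.
by rewrite mulrCA nh [t ^+ 2]expr2 !mulrA.
Qed.

(** * Contraction of Lipschitz constants and the covariance bound *)

Definition nb_lipschitz (K : R) f := forall x y, nb x y -> `|f y - f x| <= K.

Variables (rho e0 : R).
Hypothesis e0_gt0 : 0 < e0.
Hypothesis L_contract : forall (e K M : R) f, 0 <= e <= e0 -> bounded_by M f ->
  nb_lipschitz K f ->
  nb_lipschitz ((1 - rho * e) * K) (fun x => f x + e * L f x).

(** [Pt e f] is replaced by [f + e L f] at both points, and each replacement costs
    [4 * C ^+ 2 * M * e ^+ 2]. *)
Lemma sg_lip_step (e : R) K M f : 0 <= e <= e0 -> bounded_by M f ->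
  nb_lipschitz K f ->
  nb_lipschitz ((1 - rho * e) * K + 8 * C ^+ 2 * M * e ^+ 2) (Pt e f).
Proof.
move=> /[dup] ee0 /andP[e_ge0 _] bf lf x y xy.
have := sg_second_order x e_ge0 bf.
have := sg_second_order y e_ge0 bf.
have := L_contract ee0 bf lf xy.
set u := f x + _; set v := f y + _ => luv ry rx.
rewrite (_ : Pt e f y - _ = (v - u) + ((Pt e f y - f y - e * L f y) -
  (Pt e f x - f x - e * L f x))); last by rewrite /u /v; ring.
apply: le_trans (ler_normD _ _) _; apply: lerD => //.
by apply: le_trans (ler_normB _ _) _; lra.
Qed.

(** Over [k] steps of length [e] the factors [1 - rho * e], at most exp(-rho e), multiply up, while
    the errors [kappa * e ^+ 2] accumulate to order [t * e] and vanish with the step size. *)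
Lemma sg_contraction t M f : 0 <= t -> bounded_by M f -> nb_lipschitz 1 f ->
  nb_lipschitz (expR (- (rho * t))) (Pt t f).
Proof.
move=> t0 bf lf x y xy.
have M0 : 0 <= M by apply: le_trans (bf x).
(* [G] bounds exp(rho k e) whenever k e <= t. This lets each additive error be written inside the
   bracket multiplied by exp(-rho k e). *)
pose G := expR (`|rho| * t); pose kappa := 8 * C ^+ 2 * M.
have kappa0 : 0 <= kappa by rewrite !mulr_ge0 ?exprn_ge0.
have iter e k : 0 <= e <= e0 -> k%:R * e <= t ->
    nb_lipschitz (expR (- (rho * (k%:R * e))) * (1 + kappa * e ^+ 2 * k%:R * G))
      (Pt (k%:R * e) f).
  move=> /[dup] ee0 /andP[e_ge0 _]; elim: k => [|k IH] ket.
    rewrite mul0r mulr0 oppr0 expR0 mulr0 mul0r addr0 mulr1.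
    by move=> a b ab; rewrite !(ms0 msPt _ bf); exact: lf.
  have ke0 : 0 <= k%:R * e by rewrite mulr_ge0.
  have kS : k.+1%:R * e = e + k%:R * e by rewrite -natr1; ring.
  have ket' : k%:R * e <= t by lra.
  move=> a b ab; rewrite [k.+1%:R * e]kS !(msD msPt _ e_ge0 ke0 bf).
  apply: le_trans (sg_lip_step ee0 (sg_bounded ke0 bf) (IH ket') ab) _.
  rewrite -/kappa.
  set X := 1 + _ * k%:R * G.
  have X0 : 0 <= X by rewrite addr_ge0 ?mulr_ge0 ?exprn_ge0 ?expR_ge0.
  have -> : 1 + kappa * e ^+ 2 * k.+1%:R * G = X + kappa * e ^+ 2 * G.
    by rewrite -natr1 /X; ring.
  rewrite [leRHS]mulrDr.
  apply: lerD.
    rewrite [rho * (_ + _)]mulrDr opprD expRD mulrA ler_wpM2r//.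
    rewrite ler_wpM2r ?expR_ge0//.
    by rewrite (le_trans _ (expR_ge1Dx _)).
  rewrite -[leLHS]mulr1 [leRHS]mulrCA ler_wpM2l ?mulr_ge0 ?exprn_ge0//.
  rewrite /G -expRD -[leLHS]expR0 ler_expR -mulrN addrC.
  have : rho * (e + k%:R * e) <= `|rho| * t.
    apply: le_trans (ler_wpM2r _ (ler_norm rho)) _; first exact: addr_ge0.
    by rewrite ler_wpM2l// -kS.
  by rewrite mulrN; lra.
have := @le_cvg_step _ (fun e => expR (- (rho * t)) * (1 + kappa * t * G * e))
  `|Pt t f y - Pt t f x| t.
rewrite mulr0 addr0 mulr1; apply.
  apply: cvgMl_tmp; apply: cvgD; first exact: cvg_cst.
  by apply: cvgMl_tmp; exact: cvg_id.
near=> n.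
have nt : n.+1%:R * (t / n.+1%:R) = t by rewrite mulrC divfK.
have := iter (t / n.+1%:R) n.+1; rewrite nt lexx => /(_ _ isT x y xy)/wrap[].
  rewrite divr_ge0//= ler_pdivrMr// mulrC -ler_pdivrMr//.
  rewrite (@le_trans _ _ n%:R)// ?ler_nat//; near: n; exact: nbhs_infty_ger.
move=> /le_trans; apply.
rewrite [X in 1 + X](_ : _ = kappa * t * G * (t / n.+1%:R))//.
by move: (t / _) nt => e nt; rewrite -[X in kappa * X * G]nt; ring.
Unshelve. all: end_near. Qed.

Definition sg_cov t f g x := Pt t (fun y => f y * g y) x - Pt t f x * Pt t g x.

(** The law of total covariance, conditioning on the state at time [s]: the mean of the product
    [Pt t f * Pt t g] is subtracted and added back. *)
Lemma sg_covD s t M f g x : 0 <= s -> 0 <= t -> bounded_by M f ->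
  bounded_by M g ->
  sg_cov (s + t) f g x = Pt s (sg_cov t f g) x + sg_cov s (Pt t f) (Pt t g) x.
Proof.
move=> s0 t0 bf bg; rewrite /sg_cov.
have bfg := bounded_byM bf bg.
rewrite !(msD msPt _ s0 t0 bfg) !(msD msPt _ s0 t0 bf) !(msD msPt _ s0 t0 bg).
rewrite (sgB _ s0 (sg_bounded t0 bfg)
  (bounded_byM (sg_bounded t0 bf) (sg_bounded t0 bg))).
by ring.
Qed.

(** Covariance is unchanged when [f] and [g] are centred at [x]. The product [u * v] of the centred
    functions vanishes at [x] and is at most [a ^+ 2] at its neighbours, so its first-order term is
    at most [e * C * a ^+ 2]. The product of the two means is of second order. As [u * v] is bounded
    by [4 * M ^+ 2], the remainders are 16 + 4 = 20 times [C ^+ 2 * M ^+ 2 * e ^+ 2]. *)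
Lemma sg_cov_small (e a M : R) f g x : 0 <= e -> 0 <= a -> bounded_by M f ->
  bounded_by M g -> nb_lipschitz a f -> nb_lipschitz a g ->
  `|sg_cov e f g x| <= e * C * a ^+ 2 + 20 * C ^+ 2 * M ^+ 2 * e ^+ 2.
Proof.
move=> e_ge0 a0 bf bg lf lg.
have M0 : 0 <= M by apply: le_trans (bf x).
pose u y := f y - f x; pose v y := g y - g x.
have bu : bounded_by (M + M) u by apply: (bounded_byB bf) => ?; exact: bf.
have bv : bounded_by (M + M) v by apply: (bounded_byB bg) => ?; exact: bg.
have buv := bounded_byM bu bv.
have -> : sg_cov e f g x = Pt e (fun y => u y * v y) x - Pt e u x * Pt e v x.
  rewrite (sg_subr x (f x) e_ge0 bf) (sg_subr x (g x) e_ge0 bg).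
  rewrite /sg_cov (_ : (fun y => u y * v y) = fun y =>
    (- f x) * v y + (f y * g y - g x * f y)); last first.
    by apply/funext => y; rewrite /u /v; ring.
  have bfg := bounded_byM bf bg.
  rewrite (msL msPt (- f x) x e_ge0 bv
    (bounded_byB bfg (bounded_byZ (g x) bf))).
  rewrite (sgB x e_ge0 bfg (bounded_byZ (g x) bf)) (sgZ (g x) x e_ge0 bf).
  by rewrite (sg_subr x (g x) e_ge0 bg); ring.
have := sg_second_order x e_ge0 buv.
rewrite {2}/u subrr mul0r subr0 => h2.
have hL : `|L (fun y => u y * v y) x| <= C * a ^+ 2.
  apply: (L_local buv); [by rewrite exprn_ge0|by rewrite /u subrr mul0r|].
  by move=> y xy; rewrite normrM expr2 ler_pM//; [exact: lf|exact: lg].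
have u0 : `|Pt e u x| <= 2 * M * C * e.
  have := sg_lip_time x e_ge0 bf.
  by rewrite (sg_subr x (f x) e_ge0 bf).
have v0 : `|Pt e v x| <= 2 * M * C * e.
  have := sg_lip_time x e_ge0 bg.
  by rewrite (sg_subr x (g x) e_ge0 bg).
have uv0 : `|Pt e u x * Pt e v x| <= (2 * M * C * e) * (2 * M * C * e).
  by rewrite normrM ler_pM.
have eL : `|e * L (fun y => u y * v y) x| <= e * (C * a ^+ 2).
  by rewrite normrM (ger0_norm e_ge0) ler_wpM2l.
apply: le_trans (ler_normB _ _) _.
set A := Pt e _ x in h2 *.
have : `|A| <= `|A - e * L (fun y => u y * v y) x| + `|e * L (fun y => u y * v y) x|.
  by rewrite (le_trans _ (ler_normD _ _))// subrK.
move=> hA; have {}hA := le_trans hA (lerD h2 eL).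
apply: le_trans (lerD hA uv0) _.
rewrite le_eqVlt; apply/orP; left; apply/eqP; ring.
Qed.

Lemma sg_cov_bound t M f g x : 0 <= t -> bounded_by M f -> bounded_by M g ->
  nb_lipschitz 1 f -> nb_lipschitz 1 g ->
  `|sg_cov t f g x| <= C * damping rho t.
Proof.
move=> t0 bf bg lf lg.
pose kappa := 20 * C ^+ 2 * M ^+ 2.
have iter e k y : 0 <= e -> `|sg_cov (k%:R * e) f g y| <=
    C * expR (2 * `|rho| * e) * damping rho (k%:R * e) + k%:R * kappa * e ^+ 2.
  move=> e_ge0; elim: k y => [|k IH] y.
    rewrite !mul0r damping0 mulr0 addr0 /sg_cov (ms0 msPt _ (bounded_byM bf bg)).
    by rewrite (ms0 msPt _ bf) (ms0 msPt _ bg) subrr normr0.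
  have ke0 : 0 <= k%:R * e by rewrite mulr_ge0.
  have kS : k.+1%:R * e = e + k%:R * e by rewrite -natr1; ring.
  rewrite [X in sg_cov X]kS (sg_covD _ e_ge0 ke0 bf bg).
  apply: le_trans (ler_normD _ _) _.
  have := sg_cov_small y e_ge0 (expR_ge0 _) (sg_bounded ke0 bf)
    (sg_bounded ke0 bg) (sg_contraction ke0 bf lf) (sg_contraction ke0 bg lg).
  move=> /(lerD (sg_bounded e_ge0 IH y)) /le_trans; apply.
  rewrite kS (addrC e) dampingD -natr1 -/kappa.
  (* The new step contributes [C * e] times the squared contraction factor, which by [le_damping] is
     covered by the second term of [dampingD]. *)
  have := ler_wpM2l (mulr_ge0 C_ge0 (sqr_ge0 (expR (- (rho * (k%:R * e))))))
    (le_damping rho e_ge0).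
  set E := expR (2 * _ * e); set E' := expR _ ^+ 2.
  set D := damping rho e; set D' := damping rho _.
  by move=> ?; lra.
have := @le_cvg_step _
  (fun e => C * expR (2 * `|rho| * e) * damping rho t + kappa * t * e)
  `|sg_cov t f g x| t.
rewrite !mulr0 addr0 expR0 mulr1; apply.
  apply: cvgD; last by apply: cvgMl_tmp; exact: cvg_id.
  apply: cvgMr_tmp; apply: cvgMl_tmp.
  apply: (@continuous_comp _ _ _ (fun e : R => 2 * `|rho| * e) expR 0).
    by apply: cvgMl_tmp; exact: cvg_id.
  exact: continuous_expR.
near=> n.
have nt : n.+1%:R * (t / n.+1%:R) = t by rewrite mulrC divfK.
have := iter (t / n.+1%:R) n.+1 x; rewrite nt divr_ge0// => /(_ isT)/le_trans.
apply; rewrite lerD2l; move: (t / _) nt => e nt.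
by rewrite -[X in kappa * X * e]nt le_eqVlt; apply/orP; left; apply/eqP; ring.
Unshelve. all: end_near. Qed.

End generator.
End semigroup.

(** * The semigroup of a Markov process on a countable state space *)

Section discrete_integral.
Context (R : realType) (S : countType) (d : measure_display)
  (T : measurableType d) (mu : probability T R).
Variable Y : T -> S.
Hypothesis mY : forall A : set S, measurable (Y @^-1` A).

Lemma measurable_discrete (f : S -> R) D : measurable_fun D (fun w => f (Y w)).
Proof. by move=> mD A mA; apply: measurableI => //; exact: (mY (f @^-1` A)). Qed.

Lemma integrable_discrete M (f : S -> R) : bounded_by M f ->
  mu.-integrable setT (EFin \o (fun w => f (Y w))).
Proof.
move=> bf; apply: measurable_bounded_integrable => //.
- by rewrite ltey_eq fin_num_measure.
- exact: measurable_discrete.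
- exists M; split; first exact: num_real.
  by move=> M' MM' w _ /=; rewrite (le_trans (bf _))// ltW.
Qed.

(* [pickle_inv] enumerates [S]; the other indices contribute nothing. *)
Lemma integral_fibres (F : T -> R) D : measurable D ->
  measurable_fun D F -> (forall w, 0 <= F w) ->
  (\int[mu]_(w in D) (F w)%:E =
   \sum_(k <oo) if pickle_inv k is Some y then
     \int[mu]_(w in D `&` [set w | Y w = y]) (F w)%:E else 0)%E.
Proof.
move=> mD mF F0.
pose B k := D `&` [set w | choice.pickle (Y w) = k].
have BD : \bigcup_k B k = D.
  by apply/seteqP; split=> [w [k _ []]//|w Dw]; exists (choice.pickle (Y w)).
have mB k : measurable (B k).
  by apply: measurableI => //; exact: (mY [set y | choice.pickle y = k]).
rewrite -[in LHS]BD ge0_integral_bigcup//.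
- apply: eq_eseriesr => k _; rewrite /B.
  case E: (pickle_inv k) => [y|]; last first.
    rewrite (_ : _ `&` _ = set0) ?integral_set0//.
    by rewrite -subset0 => w [_ /= wk]; rewrite -wk pickleK_inv in E.
  congr (integral _ (_ `&` _) _); apply/seteqP; split=> w /= wk.
    by move: E; rewrite -wk pickleK_inv => -[].
  by have := @pickle_invK S k; rewrite E /= wk.
- by rewrite BD; exact/measurable_EFinP.
- by move=> w _; rewrite lee_fin.
- apply/trivIsetP => i j _ _ /eqP ij.
  rewrite -subset0 => w [[_ /= wi] [_ /= wj]].
  by apply: ij; rewrite -wi wj.
Qed.

Lemma integral_discrete (c : S -> R) D : measurable D -> (forall y, 0 <= c y) ->
  (\int[mu]_(w in D) (c (Y w))%:E =
   \sum_(k <oo) if pickle_inv k is Some y then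
     (c y)%:E * mu (D `&` [set w | Y w = y]) else 0)%E.
Proof.
move=> mD c0; rewrite integral_fibres//; last exact: measurable_discrete.
apply: eq_eseriesr => k _; case: pickle_inv => // y.
rewrite -integral_cst; last by apply: measurableI => //; exact: (mY [set y]).
by apply: eq_integral => w; rewrite inE => -[_ /= ->].
Qed.

End discrete_integral.

Section transition_semigroup.
Context (R : realType) (S : countType) (d : measure_display)
  (T : measurableType d).
Variables (P : S -> probability T R) (X : R -> T -> S).
Variable (L : (S -> R) -> S -> R).
Hypothesis mpX : markov_process P X L.

Definition transition (t : R) (f : S -> R) (x : S) : R :=
  \int[P x]_w f (X t w).

Lemma transitionE t f x :
  transition t f x = fine 'E_(P x)[fun w => f (X t w)].
Proof. by rewrite unlock. Qed.

Let intX t M f x (t0 : 0 <= t) (bf : bounded_by M f) :=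
  integrable_discrete (P x) (mp_measurable mpX t0) bf.

Lemma transition_fin t M f x : 0 <= t -> bounded_by M f ->
  ('E_(P x)[fun w => f (X t w)] = (transition t f x)%:E)%E.
Proof.
move=> t0 bf; rewrite transitionE fineK// unlock.
by apply: integrable_fin_num => //; exact: intX bf.
Qed.

Lemma transition_cst t c x : 0 <= t -> transition t (fun=> c) x = c.
Proof.
move=> t0; rewrite /transition Rintegral_cst//.
by rewrite /= probability_setT mulr1.
Qed.

Lemma transitionL t M M' f g a x : 0 <= t ->
  bounded_by M f -> bounded_by M' g ->
  transition t (fun y => a * f y + g y) x =
  a * transition t f x + transition t g x.
Proof.
move=> t0 bf bg; rewrite /transition -RintegralZl//; last exact: intX bf.
rewrite -RintegralD//; first exact: (intX _ _ (bounded_byZ a bf)).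
exact: intX bg.
Qed.

Lemma transition0 M f x : bounded_by M f -> transition 0 f x = f x.
Proof.
move=> bf; rewrite -[RHS](transition_cst (f x) x (lexx 0)) /transition /Rintegral.
congr fine; apply: ae_eq_integral => //.
- by apply/measurable_EFinP; apply: measurable_discrete; exact: (mp_measurable mpX).
- have mx : measurable [set w | X 0 w = x].
    exact: (mp_measurable mpX (lexx 0) [set x]).
  exists (~` [set w | X 0 w = x]); split; first exact: measurableC.
    by rewrite [LHS](probability_setC (P x) mx) (mp_start mpX) subee.
  by apply: subsetC => w /= ->.
Qed.

(** The Chapman-Kolmogorov equation: both sides are expanded over the intermediate state and then
    over the final one. Nonnegativity of [f] allows the sums to be handled in the extended reals. *)
Lemma transitionD_ge0 s t M f x : 0 <= s -> 0 <= t -> bounded_by M f ->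
  (forall y, 0 <= f y) ->
  transition (s + t) f x = transition s (transition t f) x.
Proof.
move=> s0 t0 bf f0; have st0 := addr_ge0 s0 t0.
have mX u u0 := @mp_measurable _ _ _ _ _ _ _ mpX u u0.
congr fine.
rewrite (integral_fibres (P x) (mX s s0))//; last exact/measurable_discrete/mX.
rewrite (integral_discrete (P x) (mX s s0))//; last first.
  by move=> y; apply: Rintegral_ge0.
apply: eq_eseriesr => k _; case: pickle_inv => // y.
have mD : measurable [set w | X s w = y] by exact: (mX s s0 [set y]).
rewrite !setTI (integral_discrete (P x) (mX _ st0))//.
rewrite -(transition_fin y t0 bf) expectation.unlock.
rewrite (integral_discrete (P y) (mX _ t0))// muleC.
have : P x [set w | X s w = y] \is a fin_num by exact: fin_num_measure.
move=> /fineK <-.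
rewrite -nneseriesZl; last first.
  by move=> l _; case: pickle_inv => // y'; rewrite mule_ge0 ?lee_fin.
apply: eq_eseriesr => l _; case: pickle_inv => [y'|]; last by rewrite mule0.
rewrite fineK ?fin_num_measure// muleCA setTI; congr (_ * _)%E.
(* The Markov property is taken with an empty list of earlier times, for which [visits] is the whole
   space. *)
have u : 'I_0 -> R by case.
have z : 'I_0 -> S by case.
have V : visits X u z = setT by apply/seteqP; split=> // w _ [].
have := mp_markov mpX x (u := u) z (s := s) (h := t) y y' _ s0 t0.
by rewrite V !setTI; apply; case.
Qed.

Lemma transition_semigroup : markov_semigroup transition.
Proof.
have ge0 t M f x : 0 <= t -> bounded_by M f -> (forall y, 0 <= f y) ->
    0 <= transition t f x by move=> t0 bf f0; exact: Rintegral_ge0.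
split => //.
- exact: transitionL.
- by move=> t c x t0; exact: transition_cst.
- exact: transition0.
- move=> s t M f x s0 t0 bf.
  (* Adding the constant [M] makes [f] nonnegative and commutes with [transition], which reduces the
     claim to [transitionD_ge0]. *)
  have shift u (g : S -> R) z : 0 <= u -> bounded_by M g ->
      transition u (fun y => 1 * g y + M) z = transition u g z + M.
    move=> u0 bg; rewrite (transitionL 1 z u0 bg (bounded_by_cst M)).
    by rewrite mul1r transition_cst.
  have tb : bounded_by M (transition t f).
    move=> y; have bM := bounded_byD (bounded_byZ 1 bf) (bounded_by_cst M).
    rewrite ler_norml; apply/andP; split.
      rewrite -subr_ge0 opprK -(shift t f y t0 bf).
      apply: ge0 bM _ => // z; rewrite mul1r -subr_ge0.
      by have := bf z; rewrite ler_norml => /andP[? _]; lra.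
    have bM' := bounded_byD (bounded_byZ (-1) bf) (bounded_by_cst M).
    rewrite -subr_ge0 addrC -mulN1r -[X in _ + X](transition_cst M y t0).
    rewrite -(transitionL (-1) y t0 bf (bounded_by_cst M)).
    apply: ge0 bM' _ => // z; rewrite mulN1r.
    by have := bf z; rewrite ler_norml => /andP[_ ?]; lra.
  apply: (addIr M); rewrite -(shift _ _ _ (addr_ge0 s0 t0) bf) -(shift _ _ _ s0 tb).
  rewrite (transitionD_ge0 _ s0 t0
    (bounded_byD (bounded_byZ 1 bf) (bounded_by_cst M))).
    by congr transition; apply/funext => y; rewrite (shift _ _ _ t0 bf) mul1r.
  move=> y; rewrite mul1r.
  by have := bf y; rewrite ler_norml => /andP[? _]; lra.
Qed.

Lemma transition_generator M f x : bounded_by M f ->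
  (fun h => (transition h f x - f x) / h) @ 0^'+ --> L f x.
Proof.
move=> bf; under eq_fun do rewrite transitionE.
by apply: (mp_generator mpX); exists M.
Qed.

Lemma Cov_transition t M M' f g x : 0 <= t ->
  bounded_by M f -> bounded_by M' g ->
  (Cov (P x) (fun w => f (X t w)) (fun w => g (X t w)) =
   (transition t (fun y => f y * g y) x -
    transition t f x * transition t g x)%:E)%E.
Proof.
move=> t0 bf bg; rewrite /Cov (transition_fin _ t0 bf) (transition_fin _ t0 bg).
by rewrite (transition_fin (f := fun y => f y * g y) _ t0 (bounded_byM bf bg)).
Qed.

End transition_semigroup.

(** * Absolutely summable families *)

Section rsum.
Context (R : realType) (I : choiceType).
Implicit Types (f g a b : I -> R).

Definition abs_summable f : Prop := (\esum_(j in [set: I]) `|f j|%:E < +oo)%E.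

Let nsum a : R := fine (\esum_(j in [set: I]) (a j)%:E).

Let nsumE a : (forall j, 0 <= a j) -> abs_summable a ->
  (\esum_(j in [set: I]) (a j)%:E = (nsum a)%:E)%E.
Proof.
move=> a0 sa; rewrite /nsum fineK// ge0_fin_numE; last first.
  by apply: esum_ge0 => j _; rewrite lee_fin.
by move: sa; rewrite /abs_summable; under eq_esum do rewrite ger0_norm//.
Qed.

Lemma abs_summable_le f g : (forall j, `|f j| <= `|g j|) -> abs_summable g ->
  abs_summable f.
Proof. by move=> fg; apply: le_lt_trans; apply: le_esum => j _; rewrite lee_fin. Qed.

Lemma abs_summableD f g : abs_summable f -> abs_summable g ->
  abs_summable (fun j => f j + g j).
Proof.
move=> sf sg.
apply: (@le_lt_trans _ _ (\esum_(j in [set: I]) (`|f j|%:E + `|g j|%:E)%E)).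
  by apply: le_esum => j _; rewrite -EFinD lee_fin ler_normD.
by rewrite esumD ?lte_add_pinfty// => j _; rewrite lee_fin.
Qed.

Let esumZ_le (c : R) a : 0 <= c -> (forall j, 0 <= a j) ->
  (\esum_(j in [set: I]) (c * a j)%:E <= c%:E * \esum_(j in [set: I]) (a j)%:E)%E.
Proof.
move=> c0 a0; apply: ge_ereal_sup => _ [X XI <-].
under eq_fsbigr do rewrite EFinM.
rewrite -ge0_mule_fsumr; last by move=> j; rewrite lee_fin.
by rewrite lee_wpmul2l ?lee_fin//; apply: ereal_sup_ubound; exists X.
Qed.

Lemma abs_summableZ (c : R) f : abs_summable f ->
  abs_summable (fun j => c * f j).
Proof.
move=> sf; rewrite /abs_summable; under eq_esum do rewrite normrM.
apply: le_lt_trans (esumZ_le _ _) _ => //.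
by rewrite lte_mul_pinfty// lee_fin.
Qed.

Lemma abs_summableB f g : abs_summable f -> abs_summable g ->
  abs_summable (fun j => f j - g j).
Proof.
move=> sf /(abs_summableZ (-1)) sg; have := abs_summableD sf sg.
by congr abs_summable; apply/funext => j; rewrite mulN1r.
Qed.

Lemma abs_summable_bounded M f g : bounded_by M g -> abs_summable f ->
  abs_summable (fun j => f j * g j).
Proof.
move=> bg /(abs_summableZ M); apply: abs_summable_le => j.
by rewrite !normrM mulrC ler_wpM2r// (le_trans (bg j))// ler_norm.
Qed.

Let pos f j : R := Num.max (f j) 0.
Let neg f j : R := Num.max (- f j) 0.

Let pos0 f j : 0 <= pos f j. Proof. by rewrite le_max lexx orbT. Qed.
Let neg0 f j : 0 <= neg f j. Proof. by rewrite le_max lexx orbT. Qed.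

Let pos_summable f : abs_summable f -> abs_summable (pos f).
Proof.
by apply: abs_summable_le => j; rewrite ger0_norm// ge_max ler_norm normr_ge0.
Qed.

Let neg_summable f : abs_summable f -> abs_summable (neg f).
Proof.
apply: abs_summable_le => j.
by rewrite ger0_norm// ge_max -normrN ler_norm normr_ge0.
Qed.

Let posneg f j : f j = pos f j - neg f j.
Proof.
rewrite /pos /neg; case: (lerP (f j) 0) => f0; last first.
  by rewrite max_r ?oppr_le0 ?(ltW f0)// subr0.
by rewrite max_l ?oppr_ge0// sub0r opprK.
Qed.

(** With [f = a - b], the families [pos f + b] and [neg f + a] agree termwise, and nonnegative sums
    are additive. So [rsum] may be computed from any decomposition into nonnegative summable
    families. *)
Let rsum_diff a b : (forall j, 0 <= a j) -> (forall j, 0 <= b j) ->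
  abs_summable a -> abs_summable b -> rsum (fun j => a j - b j) = nsum a - nsum b.
Proof.
move=> a0 b0 sa sb; set f := fun j => _.
have sf : abs_summable f by exact: abs_summableB.
have sp := pos_summable sf; have sn := neg_summable sf.
change (nsum (pos f) - nsum (neg f) = nsum a - nsum b).
apply/eqP; rewrite subr_eq addrAC eq_sym subr_eq eq_sym; apply/eqP.
apply: EFin_inj; rewrite !EFinD -!nsumE// -!esumD;
  try by move=> j _; rewrite lee_fin.
apply: eq_esum => j _; rewrite -!EFinD; congr EFin.
by have := posneg f j; rewrite /f; lra.
Qed.

Lemma rsumD f g : abs_summable f -> abs_summable g ->
  rsum (fun j => f j + g j) = rsum f + rsum g.
Proof.
move=> sf sg; pose a j := pos f j + pos g j; pose b j := neg f j + neg g j.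
rewrite (_ : (fun j => f j + g j) = fun j => a j - b j); last first.
  by apply/funext => j; rewrite posneg [g j]posneg /a /b; ring.
rewrite (_ : f = fun j => pos f j - neg f j); last exact/funext/posneg.
rewrite (_ : g = fun j => pos g j - neg g j); last exact/funext/posneg.
have spf := pos_summable sf; have snf := neg_summable sf.
have spg := pos_summable sg; have sng := neg_summable sg.
rewrite !rsum_diff//.
- have -> : nsum a = nsum (pos f) + nsum (pos g).
    apply: EFin_inj; rewrite EFinD -!nsumE// -?esumD//.
    + by move=> j _; rewrite lee_fin.
    + by move=> j _; rewrite lee_fin.
    + by move=> j; rewrite addr_ge0.
    + exact: abs_summableD.
  have -> : nsum b = nsum (neg f) + nsum (neg g).
    apply: EFin_inj; rewrite EFinD -!nsumE// -?esumD//.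
    + by move=> j _; rewrite lee_fin.
    + by move=> j _; rewrite lee_fin.
    + by move=> j; rewrite addr_ge0.
    + exact: abs_summableD.
  by ring.
- by move=> j; rewrite addr_ge0.
- by move=> j; rewrite addr_ge0.
- exact: abs_summableD.
- exact: abs_summableD.
Qed.

Lemma ge0_rsumE f : (forall j, 0 <= f j) ->
  rsum f = fine (\esum_(j in [set: I]) (f j)%:E).
Proof.
move=> f0; rewrite /rsum [X in _ - fine X]esum1 ?subr0.
  by congr fine; apply: eq_esum => j _; rewrite /funrpos max_l.
by move=> j _; rewrite /funrneg max_r// oppr_le0.
Qed.

Lemma ge0_rsum_fin f : (forall j, 0 <= f j) -> abs_summable f ->
  (\esum_(j in [set: I]) (f j)%:E = (rsum f)%:E)%E.
Proof. by move=> f0 sf; rewrite ge0_rsumE// nsumE. Qed.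

Lemma rsum_ge0 f : (forall j, 0 <= f j) -> 0 <= rsum f.
Proof.
by move=> f0; rewrite ge0_rsumE// fine_ge0// esum_ge0// => j _; rewrite lee_fin.
Qed.

Lemma rsum0 : rsum (fun _ : I => 0 : R) = 0.
Proof. by rewrite ge0_rsumE// esum1. Qed.

Lemma rsumN f : rsum (fun j => - f j) = - rsum f.
Proof.
rewrite /rsum opprB; congr (fine _ - fine _); apply: eq_esum => j _;
  by rewrite /funrpos /funrneg ?opprK.
Qed.

Lemma rsumB f g : abs_summable f -> abs_summable g ->
  rsum (fun j => f j - g j) = rsum f - rsum g.
Proof.
move=> sf sg; rewrite -rsumN -rsumD//.
by apply: abs_summable_le sg => j; rewrite normrN.
Qed.

Lemma le_rsum f g : abs_summable f -> abs_summable g ->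
  (forall j, f j <= g j) -> rsum f <= rsum g.
Proof.
move=> sf sg fg; rewrite -subr_ge0 -rsumB//.
by apply: rsum_ge0 => j; rewrite subr_ge0.
Qed.

Lemma rsumZ (c : R) f : abs_summable f -> rsum (fun j => c * f j) = c * rsum f.
Proof.
have ge0_Z k a : 0 <= k -> (forall j, 0 <= a j) -> abs_summable a ->
    rsum (fun j => k * a j) = k * rsum a.
  move=> k0 a0 sa; have le_Z l b : 0 <= l -> (forall j, 0 <= b j) ->
      abs_summable b -> rsum (fun j => l * b j) <= l * rsum b.
    move=> l0 b0 sb; rewrite -lee_fin EFinM -!ge0_rsum_fin ?esumZ_le//.
      by move=> j; rewrite mulr_ge0.
    exact: abs_summableZ.
  have /predU1P[<-|k1] : (0 == k) || (0 < k) by rewrite -le_eqVlt.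
    by rewrite mul0r -[RHS]rsum0; congr rsum; apply/funext => j; rewrite mul0r.
  apply/eqP; rewrite eq_le le_Z//=.
  (* The reverse inequality is [le_Z] for the factor [k^-1] and the family [k * a j]. *)
  rewrite -ler_pdivlMl//.
  rewrite [in leLHS](_ : a = fun j => k^-1 * (k * a j)); last first.
    by apply/funext => j; rewrite mulKf// gt_eqF.
  apply: le_Z; first by rewrite invr_ge0 ltW.
    by move=> j; rewrite mulr_ge0// ltW.
  exact: abs_summableZ.
have pos_Z k : 0 <= k -> forall h, abs_summable h ->
    rsum (fun j => k * h j) = k * rsum h.
  move=> k0 h sh; have sp := pos_summable sh; have sn := neg_summable sh.
  rewrite [in RHS](_ : h = fun j => pos h j - neg h j); last first.
    by apply/funext => j; exact: posneg.
  rewrite rsumB// mulrBr -!ge0_Z// -rsumB; [|exact: abs_summableZ..].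
  by congr rsum; apply/funext => j; rewrite posneg mulrBr.
move=> sf; have [c0|/ltW c0] := leP 0 c; first exact: pos_Z.
rewrite -[c]opprK mulNr -(pos_Z (- c)) ?oppr_ge0// -rsumN.
by congr rsum; apply/funext => j; rewrite mulNr.
Qed.

Lemma norm_rsum_le f g : abs_summable g -> (forall j, `|f j| <= g j) ->
  `|rsum f| <= rsum g.
Proof.
move=> sg fg; have sf : abs_summable f.
  by apply: abs_summable_le sg => j; rewrite (le_trans (fg j))// ler_norm.
rewrite ler_norml -rsumN; apply/andP; split.
  apply: le_rsum => // [|j].
    by apply: abs_summable_le sg => j; rewrite normrN.
  by rewrite lerNl (le_trans _ (fg j))// -normrN ler_norm.
by apply: le_rsum => // j; exact: le_trans (ler_norm _) (fg j).
Qed.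

Lemma esum_support f (s : {fset I}) : (forall j, 0 <= f j) ->
  (forall j, j \notin s -> f j = 0) ->
  (\esum_(j in [set: I]) (f j)%:E = (\sum_(j <- s) f j)%:E)%E.
Proof.
move=> f0 fs; rewrite -sumEFin.
have fin : finite_set [set` s] by exact: finite_fset.
transitivity (\esum_(j in [set` s]) (f j)%:E)%E.
  rewrite [RHS]esum_mkcond; apply: eq_esum => j _; case: ifPn => //.
  by rewrite notin_setE/= => /negP /fs ->.
rewrite esum_fset//; last by move=> j _; rewrite lee_fin.
by rewrite fsbig_finite//= set_fsetK.
Qed.

Lemma abs_summable_support f (s : {fset I}) :
  (forall j, j \notin s -> f j = 0) -> abs_summable f.
Proof.
move=> fs; rewrite /abs_summable (@esum_support _ s) ?ltry// => j js.
by rewrite fs ?normr0.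
Qed.

Lemma rsum_support f (s : {fset I}) :
  (forall j, j \notin s -> f j = 0) -> rsum f = \sum_(j <- s) f j.
Proof.
move=> fs; rewrite /rsum !(@esum_support _ s).
- rewrite /= -sumrB; apply: eq_bigr => j _.
  by rewrite [RHS]posneg.
- by move=> j; exact: neg0.
- by move=> j js; rewrite /funrneg fs// oppr0 maxxx.
- by move=> j; exact: pos0.
- by move=> j js; rewrite /funrpos fs// maxxx.
Qed.

Lemma rsum_delta (i : I) (c : R) : rsum (fun j : I => (j == i)%:R * c) = c.
Proof.
rewrite (@rsum_support _ (fset1 i)); last first.
  by move=> j; rewrite inE => /negbTE ->; rewrite mul0r.
by rewrite big_seq_fset1 eqxx mul1r.
Qed.

Lemma fsbig_rsum f (s : {fset I}) : (forall j, j \notin s -> f j = 0) ->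
  \sum_(j \in [set: I]) f j = rsum f.
Proof.
move=> fs; rewrite (rsum_support fs).
rewrite -(fsbig_widen [set` s] setT) => //.
  by rewrite fsbig_finite//= set_fsetK.
by move=> j [_ /= js]; apply: fs; apply/negP.
Qed.

End rsum.

(** * Moves of particles and the Fleming-Viot generator *)

Section moves.
Context (F : countType) (N : nat).
Implicit Types (x y : config F N) (i j k a b : F).

Lemma config_eq x y : (forall k, x k = y k) -> x = y.
Proof. by move=> xy; apply: val_inj; apply/fsfunP. Qed.

Lemma move_id i x : x i != 0%N -> move i i x = x.
Proof.
move=> xi; apply: config_eq => k; rewrite moveE//.
by case: eqP => [->|]; lia.
Qed.

Lemma move_target i j x : x i != 0%N -> move i j x j != 0%N.
Proof. by move=> xi; rewrite moveE// eqxx addn1. Qed.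

Lemma move_comp i j k x : x i != 0%N -> move j k (move i j x) = move i k x.
Proof.
move=> xi; apply: config_eq => l; rewrite !moveE ?eqxx ?addn1//.
by case: (l == i) (l == j) (l == k) => [] [] []; lia.
Qed.

(** The second hypothesis says that a particle remains at [i] once one has been taken from [a]. Two
    distinct particles are thus moved, and their moves commute. *)
Lemma move_swap i j a b x : x a != 0%N -> (x i - (i == a))%N != 0%N ->
  move i j (move a b x) = move a b (move i j x).
Proof.
move=> xa xi.
have xi0 : x i != 0%N by move: xi; lia.
have xa' : move i j x a != 0%N.
  rewrite moveE//; case: (eqVneq a i) xi => [<-|_]; rewrite ?eqxx; last by lia.
  by lia.
have xi' : move a b x i != 0%N by rewrite moveE//; lia.
apply: config_eq => l.
rewrite (moveE _ _ xi') (moveE _ _ xa') (moveE _ _ xa) (moveE _ _ xi0).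
have [->|_] := eqVneq l i.
  by move: xi; case: (i == a); case: (_ == j) (_ == b) => [] []; lia.
by have [->|_] := eqVneq l a; case: (_ == j) (_ == b) => [] []; lia.
Qed.

Definition move_nb x y := exists i j, [/\ x i != 0%N, i != j & y = move i j x].

Lemma move_nb_sym x y : move_nb x y -> move_nb y x.
Proof.
move=> [i [j [xi ij ->]]]; exists j, i; split; first exact: move_target.
  by rewrite eq_sym.
by rewrite move_comp// move_id.
Qed.

Lemma move_nbE (R : realType) (f : config F N -> R) (K : R) i j x : 0 <= K ->
  (forall y, move_nb x y -> `|f y - f x| <= K) -> x i != 0%N ->
  `|f (move i j x) - f x| <= K.
Proof.
move=> K0 fK xi; have [<-|ij] := eqVneq i j.
  by rewrite move_id// subrr normr0.
by apply: fK; exists i, j.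
Qed.

Lemma config_sum (R : realType) x : rsum (fun i => (x i)%:R : R) = N%:R.
Proof.
rewrite (@rsum_support _ _ _ (finsupp x)); last by move=> j /fsfun_dflt ->.
by rewrite -natr_sum; congr _%:R; exact/eqP/(valP x).
Qed.

(** Each term is at most [x j + y j], and these sum to 2N. The finite diameter makes Lipschitz
    functions bounded even when [F] is infinite. *)
Lemma d1_le (R : realType) x y : d1 R x y <= N%:R.
Proof.
have sup0 (z : config F N) (s : {fset F}) :
    (finsupp z `<=` s)%fset -> forall j, j \notin s -> z j = 0%N.
  by move=> /fsubsetP sz j; apply: contraNeq => zj; rewrite sz// mem_finsupp.
pose s := (finsupp x `|` finsupp y)%fset.
have xs := sup0 x s (fsubsetUl _ _); have ys := sup0 y s (fsubsetUr _ _).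
have sx : abs_summable (fun j => (x j)%:R : R).
  by apply: (@abs_summable_support _ _ _ s) => j /xs ->.
have sy : abs_summable (fun j => (y j)%:R : R).
  by apply: (@abs_summable_support _ _ _ s) => j /ys ->.
rewrite /d1 (@fsbig_rsum _ _ _ s); last first.
  by move=> j js; rewrite (xs _ js) (ys _ js) subrr normr0.
rewrite ler_pdivrMl//.
apply: (@le_trans _ _ (rsum (fun j => (x j)%:R + (y j)%:R : R))).
  apply: le_rsum.
  - apply: (@abs_summable_support _ _ _ s) => j js.
    by rewrite (xs _ js) (ys _ js) subrr normr0.
  - exact: abs_summableD.
  - by move=> j; rewrite (le_trans (ler_normB _ _))// !ger0_norm.
by rewrite rsumD// !config_sum; lra.
Qed.

(** Only the occupations of [i] and [j] can change, each by at most one, and the factor 1/2 halves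
    the total. *)
Lemma d1_move (R : realType) i j x : x i != 0%N -> d1 R (move i j x) x <= 1.
Proof.
move=> xi.
have moveR k : (move i j x k)%:R = (x k)%:R - (k == i)%:R + (k == j)%:R :> R.
  by rewrite moveE// natrD natrB//; case: eqVneq => // ->; rewrite lt0n.
have sd k : abs_summable (fun l => (l == k)%:R : R).
  apply: (@abs_summable_support _ _ _ (fset1 k)) => l.
  by rewrite inE => /negbTE ->.
have diff_le k :
    `|(move i j x k)%:R - (x k)%:R| <= (k == i)%:R + (k == j)%:R :> R.
  rewrite moveR (_ : _ - (x k)%:R = (k == j)%:R - (k == i)%:R); last by ring.
  by rewrite [leRHS]addrC (le_trans (ler_normB _ _))// !ger0_norm.
pose s := (fset1 i `|` fset1 j)%fset.
rewrite /d1 (@fsbig_rsum _ _ _ s); last first.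
  move=> k; rewrite !inE negb_or => /andP[/negbTE ki /negbTE kj].
  by rewrite moveR ki kj subr0 addr0 subrr normr0.
rewrite ler_pdivrMl// mulr1.
apply: (@le_trans _ _ (rsum (fun k => (k == i)%:R + (k == j)%:R : R))).
  apply: (le_rsum _ _ diff_le); last exact: abs_summableD.
  apply: (abs_summable_le _ (abs_summableD (sd i) (sd j))) => k.
  by rewrite normr_id (le_trans (diff_le k))// ler_norm.
have rd k : rsum (fun l => (l == k)%:R : R) = 1.
  by rewrite -[RHS](rsum_delta k); congr rsum; apply/funext => l; rewrite mulr1.
by rewrite rsumD// !rd.
Qed.

Lemma lipschitz1_nb (R : realType) (g : config F N -> R) :
  lipschitz1 g -> forall x y, move_nb x y -> `|g y - g x| <= 1.
Proof.
move=> hg x _ [i [j [xi _ ->]]]; exact: le_trans (hg _ _) (d1_move _ _ xi).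
Qed.

Lemma lipschitz1_bounded (R : realType) (g : config F N -> R) x :
  lipschitz1 g -> bounded_by (`|g x| + N%:R) g.
Proof.
move=> hg y; rewrite -[g y](subrK (g x)) addrC (le_trans (ler_normD _ _))//.
by rewrite lerD2l// (le_trans (hg _ _))// d1_le.
Qed.

End moves.

Section weighted_rsum.
Context (R : realType) (I : choiceType).
Implicit Types (a phi : I -> R) (c : R).

Lemma norm_weighted_rsum_le a phi c : (forall j, 0 <= a j) -> abs_summable a ->
  (forall j, a j != 0 -> `|phi j| <= c) ->
  `|rsum (fun j => a j * phi j)| <= c * rsum a.
Proof.
move=> a0 sa phic; rewrite -rsumZ//; apply: norm_rsum_le.
  exact: abs_summableZ.
move=> j; rewrite normrM ger0_norm// mulrC.
by have [->|aj] := eqVneq (a j) 0; rewrite ?mulr0// ler_wpM2r// phic.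
Qed.

Lemma weighted_rsum_le a phi c : (forall j, 0 <= a j) -> abs_summable a ->
  abs_summable (fun j => a j * phi j) -> (forall j, a j != 0 -> phi j <= c) ->
  rsum (fun j => a j * phi j) <= c * rsum a.
Proof.
move=> a0 sa sap phic; rewrite -rsumZ//; apply: le_rsum => //.
  exact: abs_summableZ.
move=> j; rewrite mulrC.
by have [->|aj] := eqVneq (a j) 0; rewrite ?mulr0// ler_wpM2r// phic.
Qed.

End weighted_rsum.

Section generator_estimates.
Context (R : realType) (F : countType) (N : nat).
Variables (Q : F -> F -> R) (p0 : F -> R) (q1 p pmin lam : R).
Hypothesis N_ge2 : (2 <= N)%N.
Hypothesis Q_ge0 : forall i j, i != j -> 0 <= Q i j.
Hypothesis Q_le : forall i,
  (\esum_(j in [set j | j != i]) (Q i j)%:E <= q1%:E)%E.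
Hypothesis p0_ge0 : forall i, 0 <= p0 i.
Hypothesis p0_le : forall i, p0 i <= p.
Hypothesis p0_ge : forall i, pmin <= p0 i.
Hypothesis lam_le : forall a b, a != b ->
  (lam%:E <= (Q a b)%:E + (Q b a)%:E +
    \esum_(j in [set j | j != a /\ j != b]) (Num.min (Q a j) (Q b j))%:E)%E.
Implicit Types (eta : config F N) (f : config F N -> R) (i j : F).

(** The diagonal rate multiplies a move from [i] to itself, which changes nothing; setting it to 0
    makes all weights nonnegative. *)
Let Qo i j : R := if j == i then 0 else Q i j.

Let Qo_ge0 i j : 0 <= Qo i j.
Proof. by rewrite /Qo; case: eqVneq => // ji; rewrite Q_ge0// eq_sym. Qed.

Let Qo_esum i : (\esum_(j in [set: F]) (Qo i j)%:E <= q1%:E)%E.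
Proof.
apply: le_trans (Q_le i); rewrite [leRHS]esum_mkcond; apply: le_esum => j _.
by rewrite /Qo; case: eqVneq => ji; [rewrite memNset//= ji eqxx|rewrite mem_set].
Qed.

Let Qo_summable i : abs_summable (Qo i).
Proof.
rewrite /abs_summable; under eq_esum do rewrite ger0_norm//.
by rewrite (le_lt_trans (Qo_esum i))// ltry.
Qed.

Let Qo_rsum i : rsum (Qo i) <= q1.
Proof. by rewrite -lee_fin -ge0_rsum_fin. Qed.

Let config_summable eta phi : abs_summable (fun j => (eta j)%:R * phi j : R).
Proof.
apply: (@abs_summable_support _ _ _ (finsupp eta)) => j /fsfun_dflt ->.
by rewrite mul0r.
Qed.

Let config_abs_summable eta : abs_summable (fun j => (eta j)%:R : R).
Proof.
apply: (abs_summable_le _ (config_summable eta (fun=> 1))) => j.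
by rewrite mulr1.
Qed.

Let w i : R := p0 i / (N%:R - 1).

Let N1_gt0 : 0 < N%:R - 1 :> R.
Proof. by rewrite subr_gt0 ltr1n. Qed.

Let w_ge0 i : 0 <= w i. Proof. by rewrite divr_ge0// ltW. Qed.

Let w_le i : w i <= p / (N%:R - 1).
Proof. by rewrite ler_wpM2r ?invr_ge0// ltW. Qed.

(** Contribution of a single particle at [i]: its own jumps, then its death followed by rebirth at
    the site of a particle. The second sum may run over all of [eta], since rebirth at [i] is a
    trivial move. *)
Let drift f eta i : R :=
  rsum (fun j => Qo i j * (f (move i j eta) - f eta)) +
  w i * rsum (fun j => (eta j)%:R * (f (move i j eta) - f eta)).

Let mut_summable M f eta i j' : bounded_by M f ->
  abs_summable (fun j => Qo i j * (f (move j' j eta) - f eta)).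
Proof.
move=> bf; apply: (@abs_summable_bounded _ _ (M + M)) => // j.
by rewrite (le_trans (ler_normB _ _))// lerD.
Qed.

Let fv_generatorE M f eta : bounded_by M f ->
  fv_generator Q p0 f eta = rsum (fun i => (eta i)%:R * drift f eta i).
Proof.
move=> bf; rewrite /fv_generator (@fsbig_rsum _ _ _ (finsupp eta)); last first.
  by move=> i /fsfun_dflt ->; rewrite mul0r.
congr rsum; apply/funext => i; have [->|ei] := eqVneq (eta i) 0%N.
  by rewrite !mul0r.
congr (_ * _); rewrite /drift -rsumZ//.
rewrite -rsumD; [|exact: mut_summable bf|exact/abs_summableZ].
congr rsum; apply/funext => j; rewrite /Qo /w; case: eqVneq => [->|_].
  by rewrite move_id// subrr !(mul0r, mulr0) addr0.
by ring.
Qed.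

(** Each of the N particles jumps at total rate at most [q1] plus [p * N / (N - 1)], where the N in
    the numerator counts the particle itself as a possible target of rebirth. *)
Lemma fv_generator_local M f eta (c : R) : bounded_by M f -> 0 <= c ->
  f eta = 0 ->
  (forall y, move_nb eta y -> `|f y| <= c) ->
  `|fv_generator Q p0 f eta| <= (N%:R * q1 + p * (N%:R ^+ 2 / (N%:R - 1))) * c.
Proof.
move=> bf c0 f0 fc; rewrite (fv_generatorE eta bf).
rewrite (_ : (_ + _) * c = (c * q1 + p / (N%:R - 1) * (c * N%:R)) * N%:R);
  last by ring.
rewrite -[X in _ * X](config_sum R eta); apply: norm_weighted_rsum_le => // i.
rewrite pnatr_eq0 => ei.
have fm j : `|f (move i j eta) - f eta| <= c.
  by apply: move_nbE => // y /fc; rewrite f0 subr0.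
rewrite /drift (le_trans (ler_normD _ _))// lerD//.
  apply: le_trans (norm_weighted_rsum_le (c := c) _ _ _) _ => //.
  by rewrite ler_wpM2l.
rewrite normrM ger0_norm// ler_pM//.
by rewrite -(config_sum R eta); exact: norm_weighted_rsum_le.
Qed.

(** * Coupling of the generators at two configurations one move apart *)

Section coupling.
Variables (M K : R) (f : config F N -> R) (eta : config F N) (a b : F).
Hypothesis bf : bounded_by M f.
Hypothesis f_lip : forall x y, move_nb x y -> `|f y - f x| <= K.
Hypothesis eta_a : eta a != 0%N.
Hypothesis ab : a != b.

Let eta' := move a b eta.
(** The slack [K - D] is nonnegative. Drift terms proportional to it are harmless, as a short time
    step absorbs them. *)
Let D := f eta - f eta'.
(** The N - 1 particles common to both configurations; [eta] has one more at [a] and [eta'] one more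
    at [b]. *)
Let xi k := (eta k - (k == a))%N.

Let eta'_b : eta' b != 0%N. Proof. exact: move_target. Qed.

Let eta_xi k : eta k = (xi k + (k == a))%N.
Proof. by rewrite /xi subnK//; case: eqVneq => // ->; rewrite lt0n. Qed.

Let eta'_xi k : eta' k = (xi k + (k == b))%N.
Proof. by rewrite /eta' moveE. Qed.

Let K_ge0 : 0 <= K.
Proof.
have : move_nb eta eta' by exists a, b.
by move=> /f_lip; exact: le_trans.
Qed.

Let lip_move (x : config F N) i j : x i != 0%N -> `|f (move i j x) - f x| <= K.
Proof. by apply: move_nbE => // y; exact: f_lip. Qed.

Let D_le : D <= K.
Proof.
by apply: le_trans (ler_norm _) _; rewrite distrC; exact: lip_move.
Qed.

Let xi_summable phi : abs_summable (fun j => (xi j)%:R * phi j : R).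
Proof.
apply: (@abs_summable_support _ _ _ (finsupp eta)) => j /fsfun_dflt ej.
by rewrite /xi ej sub0n mul0r.
Qed.

Let xi_abs_summable : abs_summable (fun j => (xi j)%:R : R).
Proof.
by apply: (abs_summable_le _ (xi_summable (fun=> 1))) => j; rewrite mulr1.
Qed.

Let delta_summable c (phi : F -> R) :
  abs_summable (fun j => (j == c)%:R * phi j : R).
Proof.
apply: (@abs_summable_support _ _ _ (fset1 c)) => j.
by rewrite inE => /negbTE ->; rewrite mul0r.
Qed.

Let rsum_dirac c (phi : F -> R) : rsum (fun j => (j == c)%:R * phi j) = phi c.
Proof.
rewrite -[RHS](rsum_delta c); congr rsum; apply/funext => j.
by case: eqVneq => [->//|_]; rewrite !mul0r.
Qed.

Let rsum_eta phi : rsum (fun j => (eta j)%:R * phi j) =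
  rsum (fun j => (xi j)%:R * phi j) + phi a :> R.
Proof.
rewrite -(rsum_dirac a phi) -rsumD//; congr rsum; apply/funext => j.
by rewrite eta_xi natrD mulrDl.
Qed.

Let rsum_eta' phi : rsum (fun j => (eta' j)%:R * phi j) =
  rsum (fun j => (xi j)%:R * phi j) + phi b :> R.
Proof.
rewrite -(rsum_dirac b phi) -rsumD//; congr rsum; apply/funext => j.
by rewrite eta'_xi natrD mulrDl.
Qed.

Let xi_rsum : rsum (fun j => (xi j)%:R) = N%:R - 1 :> R.
Proof.
have := rsum_eta (fun=> 1); rewrite -(config_sum R eta) => h.
apply/eqP; rewrite -subr_eq opprK; apply/eqP.
transitivity (rsum (fun j => (xi j)%:R * 1) + 1 : R).
  by congr (rsum _ + _); apply/funext => j; rewrite mulr1.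
by rewrite -h; congr rsum; apply/funext => j; rewrite mulr1.
Qed.

(* The particles of [xi] move together in both configurations, unless one of
   them jumps onto the discrepancy. *)
Let drift_common i : xi i != 0%N -> drift f eta i - drift f eta' i <=
  (q1 + p / (N%:R - 1) * N%:R) * (K - D) + p / (N%:R - 1) * K.
Proof.
move=> xi_i; have ei : eta i != 0%N by move: xi_i; rewrite /xi; lia.
have ei' : eta' i != 0%N by rewrite eta'_xi addn_eq0 (negbTE xi_i).
have KD : 0 <= K - D by rewrite subr_ge0.
have fm j : `|f (move i j eta) - f (move i j eta')| <= K.
  rewrite distrC /eta' move_swap//; apply: lip_move.
  by rewrite moveE// eta_xi; case: (eqVneq a i) xi_i => [<-|]; rewrite eqxx; lia.
(* After a joint move the configurations are still one move apart, so the difference of [f] can grow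
   from [D] to at most [K]. *)
have sm j : (f (move i j eta) - f eta) - (f (move i j eta') - f eta') <= K - D.
  by have := le_trans (ler_norm _) (fm j); rewrite /D; lra.
have fab : `|f (move i a eta) - f (move i b eta)| <= K.
  have -> : move i b eta = move a b (move i a eta) by rewrite move_comp.
  by rewrite distrC; apply: lip_move; exact: move_target.
(* When the particle is reborn on the discrepancy, at [a] in one configuration and at [b] in the
   other, the results are two moves apart. The additional [K] occurs at rate at most
   [p / (N%:R - 1)] per particle. *)
have sab : (f (move i a eta) - f eta) - (f (move i b eta') - f eta') <=
    K + (K - D).
  have := le_trans (ler_norm _) fab; have := le_trans (ler_norm _) (fm b).
  by rewrite /D; lra.
rewrite /drift rsum_eta rsum_eta'.
have mut : rsum (fun j => Qo i j * (f (move i j eta) - f eta)) -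
    rsum (fun j => Qo i j * (f (move i j eta') - f eta')) <= q1 * (K - D).
  rewrite -rsumB; [|exact: mut_summable bf..].
  rewrite (_ : (fun j => _) = fun j => Qo i j *
    ((f (move i j eta) - f eta) - (f (move i j eta') - f eta'))); last first.
    by apply/funext => j; rewrite -mulrBr.
  apply: le_trans (weighted_rsum_le (c := K - D) _ _ _ _) _ => //.
    have := abs_summableB (mut_summable eta i i bf) (mut_summable eta' i i bf).
    by congr abs_summable; apply/funext => j; rewrite -mulrBr.
  by rewrite mulrC ler_wpM2r.
have sel : rsum (fun j => (xi j)%:R * (f (move i j eta) - f eta)) -
    rsum (fun j => (xi j)%:R * (f (move i j eta') - f eta')) <=
    (N%:R - 1) * (K - D).
  rewrite -rsumB//.
  rewrite (_ : (fun j => _) = fun j => (xi j)%:R *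
    ((f (move i j eta) - f eta) - (f (move i j eta') - f eta'))); last first.
    by apply/funext => j; rewrite -mulrBr.
  by rewrite mulrC -xi_rsum; apply: weighted_rsum_le.
set m := rsum _ in mut *; set m' := rsum _ in mut *.
set s := rsum _ in sel *; set s' := rsum _ in sel *.
have tot : (s + (f (move i a eta) - f eta)) -
    (s' + (f (move i b eta') - f eta')) <= N%:R * (K - D) + K by lra.
have wtot := ler_wpM2l (w_ge0 i) tot.
have NKD : 0 <= N%:R * (K - D) + K by rewrite addr_ge0// mulr_ge0.
have := ler_wpM2r NKD (w_le i).
lra.
Qed.

(* At the discrepancy the particles at [a] and [b] jump together to [j] at rate
   [min (Q a j) (Q b j)] and are replaced together at rate [min (p0 a) (p0 b)]. *)
Let drift_discrepancy : drift f eta a - drift f eta' b <=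
  - (lam + pmin) * K + (4 * q1 + 3 * p) * (K - D).
Proof.
pose Fj j := f (move a j eta).
have fa : f eta = Fj a by rewrite /Fj move_id.
have fb : f eta' = Fj b by [].
have fj j : f (move b j eta') = Fj j by rewrite /eta' move_comp.
have FF i j : Fj i - Fj j <= K.
  apply: le_trans (ler_norm _) _; rewrite /Fj.
  have -> : move a i eta = move j i (move a j eta) by rewrite move_comp.
  by apply: lip_move; exact: move_target.
have KD : 0 <= K - D by rewrite subr_ge0.
have DF : D = Fj a - Fj b by rewrite /D fa.
rewrite /drift rsum_eta rsum_eta'.
rewrite move_id// move_id// !subrr !addr0.
have q1_ge0 : 0 <= q1 by apply: le_trans (rsum_ge0 (Qo_ge0 a)) (Qo_rsum a).
have sa : abs_summable (fun j => Qo a j * (f (move a j eta) - f eta)).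
  exact: mut_summable bf.
have sb : abs_summable (fun j => Qo b j * (f (move b j eta') - f eta')).
  exact: mut_summable bf.
(* [m] is the rate at which the two discrepant particles meet at [j]. For [j] equal to [a] or [b]
   one of them jumps onto the other, and for other [j] they jump there together. The three parts of
   its sum are those in the definition of [lambda]. *)
pose m j :=
  if (j == a) || (j == b) then Qo a j + Qo b j else Num.min (Q a j) (Q b j).
have m_ge0 j : 0 <= m j.
  rewrite /m; case: ifPn => [_|]; first by rewrite addr_ge0.
  by rewrite negb_or => /andP[ja jb]; rewrite le_min !Q_ge0// eq_sym.
have m_le j : m j <= Qo a j + Qo b j.
  rewrite /m; case: ifPn => //; rewrite negb_or => /andP[ja jb].
  by rewrite /Qo (negbTE ja) (negbTE jb) ge_min lerDl Q_ge0// eq_sym.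
have s_sum : abs_summable (fun j => Qo a j + Qo b j) by exact: abs_summableD.
have sm : abs_summable m.
  apply: abs_summable_le s_sum => j; rewrite !ger0_norm//; exact: addr_ge0.
have m_rsum : lam <= rsum m.
  rewrite -lee_fin -ge0_rsum_fin//; apply: le_trans (lam_le ab) _.
  pose m1 j := (j == b)%:R * Q a b; pose m2 j := (j == a)%:R * Q b a.
  pose m3 j := if (j == a) || (j == b) then 0 else m j.
  have m1_ge0 j : 0 <= m1 j by rewrite mulr_ge0// Q_ge0.
  have m2_ge0 j : 0 <= m2 j by rewrite mulr_ge0// Q_ge0// eq_sym.
  have m3_ge0 j : 0 <= m3 j by rewrite /m3; case: ifP.
  have -> : (\esum_(j in [set: F]) (m j)%:E = \esum_(j in [set: F]) (m1 j)%:E +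
      \esum_(j in [set: F]) (m2 j)%:E + \esum_(j in [set: F]) (m3 j)%:E)%E.
    rewrite -!esumD; try by move=> j _; rewrite -?EFinD lee_fin ?addr_ge0.
    apply: eq_esum => j _; rewrite -!EFinD; congr EFin.
    rewrite /m1 /m2 /m3 /m; have [->|ja] := eqVneq j a.
      by rewrite (negbTE ab) /Qo eqxx (negbTE ab) /=; ring.
    have [->|jb] := eqVneq j b.
      by rewrite /Qo eqxx eq_sym (negbTE ab) /=; ring.
    by rewrite /=; ring.
  rewrite (ge0_rsum_fin m1_ge0 (delta_summable _ (fun=> Q a b))) rsum_delta.
  rewrite (ge0_rsum_fin m2_ge0 (delta_summable _ (fun=> Q b a))) rsum_delta.
  rewrite leeD2l// esum_mkcond; apply: le_esum => j _.
  case: ifPn => [|_]; last by rewrite lee_fin.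
  by rewrite inE/= /m3 /m => -[/negbTE -> /negbTE ->].
(* A meeting cancels the difference [D]. The remaining jumps raise it by at most [K - D] each, at
   rates bounded by [Qo a j + Qo b j]. *)
have mut : rsum (fun j => Qo a j * (f (move a j eta) - f eta)) -
    rsum (fun j => Qo b j * (f (move b j eta') - f eta')) <=
    - D * rsum m + (K - D) * (q1 + q1).
  rewrite -rsumB//.
  apply: (@le_trans _ _
    (rsum (fun j => - D * m j + (K - D) * (Qo a j + Qo b j)))).
    apply: le_rsum.
    - exact: abs_summableB.
    - by apply: abs_summableD; exact: abs_summableZ.
    move=> j; rewrite fj fa fb -/(Fj j).
    have := FF j b; have := FF a j; have := FF j a; have := FF b j.
    rewrite /m; have [->|ja] := eqVneq j a => /=.
      have : 0 <= Qo b a * (K - D) by rewrite mulr_ge0.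
      by rewrite /Qo eqxx DF => ? _ _ _ _; lra.
    have [->|jb] := eqVneq j b => /=.
      have : 0 <= Qo a b * (K - D) by rewrite mulr_ge0.
      by rewrite /Qo eqxx DF => ? _ _ _ _; lra.
    rewrite /Qo (negbTE ja) (negbTE jb) => _ FjFa FaFj FjFb.
    have Qa : 0 <= Q a j by rewrite Q_ge0// eq_sym.
    have Qb : 0 <= Q b j by rewrite Q_ge0// eq_sym.
    have h1 : Fj j - Fj a <= K - D by lra.
    have h2 : Fj b - Fj j <= K - D by lra.
    have [Qab|/ltW Qba] := leP (Q a j) (Q b j).
      have d0 : 0 <= Q b j - Q a j by lra.
      have := ler_wpM2l d0 h2; have : 0 <= Q a j * (K - D) by rewrite mulr_ge0.
      by rewrite DF; lra.
    have d0 : 0 <= Q a j - Q b j by lra.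
    have := ler_wpM2l d0 h1; have : 0 <= Q b j * (K - D) by rewrite mulr_ge0.
    by rewrite DF; lra.
  rewrite rsumD; [|exact: abs_summableZ..].
  rewrite rsumZ// rsumZ// rsumD// lerD2l ler_wpM2l// lerD//.
have m_rsum_le : rsum m <= q1 + q1.
  apply: le_trans (le_rsum sm s_sum m_le) _.
  by rewrite rsumD// lerD.
pose mu := Num.min (w a) (w b).
have mu_le : mu <= w a /\ mu <= w b by rewrite /mu !ge_min !lexx orbT.
(* Common rebirths at rate [mu] onto each particle of [xi] cancel [D]; the excess rates of [a] and
   of [b] cost at most [K - D]. *)
have sel : w a * rsum (fun j => (xi j)%:R * (f (move a j eta) - f eta)) -
    w b * rsum (fun j => (xi j)%:R * (f (move b j eta') - f eta')) <=
    (- mu * D + (w a + w b) * (K - D)) * (N%:R - 1).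
  rewrite -!rsumZ// -rsumB; [|exact: abs_summableZ..].
  rewrite (_ : (fun j => _) = fun j => (xi j)%:R *
    (w a * (Fj j - Fj a) - w b * (Fj j - Fj b))); last first.
    by apply/funext => j; rewrite fj fa fb -/(Fj j); ring.
  rewrite -xi_rsum; apply: weighted_rsum_le => // j _.
  have h1 : Fj j - Fj a <= K - D by have := FF j b; lra.
  have h2 : Fj b - Fj j <= K - D by have := FF a j; lra.
  have wa0 : 0 <= w a - mu by case: mu_le; lra.
  have wb0 : 0 <= w b - mu by case: mu_le; lra.
  have mu0 : 0 <= mu * (K - D) by rewrite mulr_ge0// le_min !w_ge0.
  have := ler_wpM2l wa0 h1; have := ler_wpM2l wb0 h2.
  by rewrite DF in mu0 *; lra.
have wN i : w i * (N%:R - 1) = p0 i by rewrite /w divfK// gt_eqF.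
have muN : pmin <= mu * (N%:R - 1) <= p.
  by rewrite /mu; case: (leP (w a) (w b)) => _; rewrite wN p0_ge p0_le.
(* Writing [D] as [K - (K - D)] costs [p * (K - D)], and the rates at [a] and [b] cost [p * (K - D)]
   each, whence the 3. *)
have {}sel : w a * rsum (fun j => (xi j)%:R * (f (move a j eta) - f eta)) -
    w b * rsum (fun j => (xi j)%:R * (f (move b j eta') - f eta')) <=
    - pmin * K + 3 * p * (K - D).
  apply: le_trans sel _.
  rewrite (_ : _ * (N%:R - 1) = - (mu * (N%:R - 1)) * D +
    (w a * (N%:R - 1) + w b * (N%:R - 1)) * (K - D)); last by ring.
  rewrite !wN; case/andP: muN; set v := mu * _ => v1 v2.
  have := ler_wpM2r KD (p0_le a); have := ler_wpM2r KD (p0_le b).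
  have := ler_wpM2r KD v2; have := ler_wpM2r K_ge0 v1; lra.
(* Likewise [4 * q1] collects [2 * q1] from [rsum m] and [2 * q1] from the uncoupled jumps. *)
have {}mut : rsum (fun j => Qo a j * (f (move a j eta) - f eta)) -
    rsum (fun j => Qo b j * (f (move b j eta') - f eta')) <=
    - lam * K + 4 * q1 * (K - D).
  apply: le_trans mut _.
  have := ler_wpM2r K_ge0 m_rsum; have := ler_wpM2r KD m_rsum_le; lra.
lra.
Qed.

Let B := (N%:R - 1) * q1 + p * N%:R + 4 * q1 + 3 * p.

(** Common particles are paired with themselves and the one at [a] with the one at [b]. The N - 1
    common particles lose [p * K] in total through rebirth on the discrepancy, while the discrepancy
    gains [(lam + pmin) * K]. All other terms are multiples of the slack. *)
Lemma fv_generator_coupling :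
  fv_generator Q p0 f eta - fv_generator Q p0 f eta' <=
  - (lam - (p - pmin)) * K + B * (K - D).
Proof.
rewrite (fv_generatorE eta bf) (fv_generatorE eta' bf) rsum_eta rsum_eta'.
rewrite opprD addrACA -rsumB//.
rewrite (_ : (fun j => _) = fun i => (xi i)%:R *
    (drift f eta i - drift f eta' i)); last by apply/funext => i; rewrite -mulrBr.
set c := (q1 + p / (N%:R - 1) * N%:R) * (K - D) + p / (N%:R - 1) * K.
have h : rsum (fun i => (xi i)%:R * (drift f eta i - drift f eta' i)) <=
    c * (N%:R - 1).
  rewrite -xi_rsum; apply: weighted_rsum_le => // i.
  by rewrite pnatr_eq0; exact: drift_common.
apply: le_trans (lerD h drift_discrepancy) _.
rewrite (_ : c * _ = (q1 * (N%:R - 1) + p * N%:R) * (K - D) + p * K);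
  last first.
  by rewrite /c; field; rewrite gt_eqF.
by rewrite /B; lra.
Qed.

End coupling.

Lemma fv_generator_contract : exists2 e0 : R, 0 < e0 &
  forall (e K M : R) f, 0 <= e <= e0 -> bounded_by M f ->
    (forall x y, move_nb x y -> `|f y - f x| <= K) ->
    forall x y, move_nb x y ->
      `|f y + e * fv_generator Q p0 f y - (f x + e * fv_generator Q p0 f x)| <=
      (1 - (lam - (p - pmin)) * e) * K.
Proof.
pose B := (N%:R - 1) * q1 + p * N%:R + 4 * q1 + 3 * p.
exists (`|B| + 1)^-1; first by rewrite invr_gt0 ltr_wpDl.
move=> e K M f /andP[e0 eB] bf fK.
suff side x y : move_nb x y -> f x + e * fv_generator Q p0 f x -
    (f y + e * fv_generator Q p0 f y) <= (1 - (lam - (p - pmin)) * e) * K.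
  move=> x y xy; rewrite ler_norml side ?andbT; last exact: move_nb_sym.
  by have := side _ _ xy; lra.
move=> xy; have := fK _ _ xy; case: xy => [i [j [xi ij ->]]].
move=> /ler_normlP[]; set D := - _ => DK _.
have := ler_wpM2l e0 (fv_generator_coupling bf fK xi ij).
rewrite -/B; have KD : 0 <= K - D by rewrite subr_ge0.
have eB1 : e * B <= 1.
  apply: le_trans (ler_wpM2l e0 (ler_norm B)) _.
  apply: le_trans (ler_wpM2r _ eB) _ => //.
  by rewrite ler_pdivrMl ?mulr1 ?lerDl// ltr_wpDl.
by have := ler_wpM2r KD eB1; rewrite /D; lra.
Qed.

End generator_estimates.

(** * Finiteness of the extended-real parameters *)

Section rates.
Context (R : realType) (F : countType).
Variables (Q : F -> F -> R) (p0 : F -> R).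

Lemma decay_factorE (r t : R) : decay_factor r%:E t = (damping r t)%:E.
Proof.
rewrite /decay_factor /damping eqe; case: eqVneq => // r0.
rewrite [X in (_ * X)%E](_ : _ = ((2 * r)^-1)%:E)// /inve /=.
by rewrite mulf_eq0 pnatr_eq0 (negbTE r0).
Qed.

Lemma sup_rateE (i0 : F) : (forall i, 0 <= p0 i) -> (sup_rate p0 < +oo)%E ->
  sup_rate p0 = (fine (sup_rate p0))%:E.
Proof.
move=> p00 poo; rewrite fineK// fin_numE (lt_eqF poo) andbT gt_eqF//.
apply: (@lt_le_trans _ _ (p0 i0)%:E); first exact: ltNyr.
by apply: ereal_sup_ubound; exists i0.
Qed.

Lemma inf_rateE (i0 : F) : (forall i, 0 <= p0 i) ->
  inf_rate p0 = (fine (inf_rate p0))%:E.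
Proof.
move=> p00; rewrite fineK// fin_numE; apply/andP; split.
  rewrite gt_eqF//; apply: (@lt_le_trans _ _ 0%E); first exact: ltNy0.
  by apply: le_ereal_inf_tmp => _ [i _ <-]; rewrite lee_fin.
rewrite lt_eqF//; apply: (@le_lt_trans _ _ (p0 i0)%:E); last exact: ltry.
by apply: ereal_inf_lbound; exists i0.
Qed.

Lemma sup_jump_rateE (i0 : F) : transition_rate_matrix Q ->
  (sup_jump_rate Q < +oo)%E -> sup_jump_rate Q = (fine (sup_jump_rate Q))%:E.
Proof.
move=> [Q0 _] qoo; rewrite fineK// fin_numE (lt_eqF qoo) andbT gt_eqF//.
apply: (@lt_le_trans _ _ 0%E); first exact: ltNy0.
apply: ereal_sup_ge.
exists (\esum_(j in [set j | j != i0]) (Q i0 j)%:E)%E; first by exists i0.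
by apply: esum_ge0 => j /= ji; rewrite lee_fin Q0// eq_sym.
Qed.

Lemma lambdaE (a b : F) : a != b -> transition_rate_matrix Q ->
  lambda Q = (fine (lambda Q))%:E.
Proof.
move=> ab [Q0 Qd]; rewrite fineK// fin_numE; apply/andP; split.
  rewrite gt_eqF//; apply: (@lt_le_trans _ _ 0%E); first exact: ltNy0.
  apply: le_ereal_inf_tmp => _ [[i j] /= ij <-].
  rewrite !adde_ge0 ?lee_fin ?Q0//; first by rewrite eq_sym.
  by apply: esum_ge0 => k /= [ki kj]; rewrite lee_fin le_min !Q0// eq_sym.
rewrite lt_eqF//; apply: (@le_lt_trans _ _ ((Q a b)%:E + (Q b a)%:E +
      \esum_(j in [set j | j != a /\ j != b]) (Num.min (Q a j) (Q b j))%:E)%E).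
  by apply: ereal_inf_lbound; exists (a, b).
rewrite -EFinD lte_add_pinfty ?ltry//.
(* The minimum is at most [Q a j], and the rates out of [a] sum to [- Q a a]. *)
apply: (@le_lt_trans _ _ (- Q a a)%:E); last exact: ltry.
rewrite -Qd esum_mkcond [leRHS]esum_mkcond; apply: le_esum => j _.
case: ifPn.
  by rewrite inE/= => -[ja jb]; rewrite mem_set// lee_fin ge_min lexx.
by case: ifPn => //; rewrite inE/= => ja _; rewrite lee_fin Q0// eq_sym.
Qed.

End rates.

(** All N particles sit at the only site. This settles the degenerate case in which [lambda Q] is
    [+oo]. *)
Lemma config_subsingleton (F : countType) (N : nat) (x y : config F N) :
  (forall i j : F, i = j) -> x = y.
Proof.
move=> F1; apply: config_eq => k.
have val (z : config F N) : z k = N.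
  rewrite -[RHS](eqP (valP z)) (big_fset_incl _ (B := (k |` finsupp z)%fset)).
  - rewrite (_ : (k |` _)%fset = fset1 k) ?big_seq_fset1//.
    by apply/fsetP => l; rewrite (F1 l k) !inE eqxx.
  - by apply/fsubsetP => l lz; rewrite !inE lz orbT.
  - by move=> l _ /fsfun_dflt.
by rewrite !val.
Qed.

Theorem theorem2p5 (R : realType) (F : countType)
    (Q : F -> F -> R) (p0 : F -> R) (N : nat)
    (hQ : transition_rate_matrix Q)
    (hQrec : irreducible_positive_recurrent Q)
    (p0_ge0 : forall i, 0 <= p0 i)
    (p0_neq0 : exists i, p0 i != 0)
    (hN : (2 <= N)%N)
    (hQ1 : (sup_jump_rate Q < +oo)%E)
    (hp : (sup_rate p0 < +oo)%E)
    (d : measure_display) (T : measurableType d)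
    (P : config F N -> probability T R) (eta_ : R -> T -> config F N)
    (hFV : markov_process P eta_ (fv_generator Q p0))
    (g h : config F N -> R) (hg : lipschitz1 g) (hh : lipschitz1 h)
    (t : R) (ht : 0 <= t) (eta : config F N) :
  (`| Cov (P eta) (fun w => g (eta_ t w)) (fun w => h (eta_ t w)) | <=
   decay_factor (rho Q p0) t *
   (N%:R%:E * sup_jump_rate Q + sup_rate p0 * (N%:R ^+ 2 / (N%:R - 1))%:E))%E.
Proof.
have [i0 _] := p0_neq0.
have bg := lipschitz1_bounded eta hg; have bh := lipschitz1_bounded eta hh.
have supE := sup_rateE i0 p0_ge0 hp; have infE := inf_rateE i0 p0_ge0.
have jumpE := sup_jump_rateE i0 hQ hQ1.
rewrite (Cov_transition hFV eta ht bg bh).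
(* On a one-site space every function of the configuration is constant, so the covariance is 0; the
   right-hand side is 0 as well, since [rho Q p0] is [+oo] and division by [+oo] gives 0. *)
have [F1|] := pselect (forall i j : F, i = j).
  rewrite (_ : rho Q p0 = +oo%E); last first.
    rewrite /rho supE infE (_ : lambda Q = +oo%E)//.
    rewrite /lambda (_ : [set _ | _ in _] = set0) ?ereal_inf0//.
    by apply/seteqP; split=> // x [[i j] /=]; rewrite (F1 i j) eqxx.
  have cst (f : config F N -> R) : f = (fun=> f eta).
    by apply/funext => x; rewrite (config_subsingleton x eta F1).
  rewrite (cst g) (cst h) !transition_cst// subrr abse0.
  rewrite (_ : decay_factor _ _ = 0%E) ?mul0e//.
  by rewrite /decay_factor /= mulry gtr0_sg// mul1e /= mule0.
(* Two distinct sites make [lambda Q] finite, so that the inequality becomes one between reals. *)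
move=> /existsNP[a /existsNP[b /eqP ab]].
have lamE := lambdaE ab hQ.
rewrite /rho lamE supE infE jumpE -!EFinB decay_factorE -!EFinM.
rewrite abse_EFin lee_fin.
rewrite [leRHS]mulrC; set q1 := fine (sup_jump_rate Q) in jumpE *.
set p := fine (sup_rate p0) in supE *; set pmin := fine (inf_rate p0) in infE *.
set lam := fine (lambda Q) in lamE *.
have Q_le i : (\esum_(j in [set j | j != i]) (Q i j)%:E <= q1%:E)%E.
  by rewrite -jumpE; apply: ereal_sup_ubound; exists i.
have p0_le i : p0 i <= p.
  by rewrite -lee_fin -supE; apply: ereal_sup_ubound; exists i.
have p0_ge i : pmin <= p0 i.
  by rewrite -lee_fin -infE; apply: ereal_inf_lbound; exists i.
have lam_le i j : i != j -> (lam%:E <= (Q i j)%:E + (Q j i)%:E +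
    \esum_(k in [set k | k != i /\ k != j]) (Num.min (Q i k) (Q j k))%:E)%E.
  by move=> ij; rewrite -lamE; apply: ereal_inf_lbound; exists (i, j).
have [Q_ge0 _] := hQ.
have [e0 e0_gt0 contract] :=
  fv_generator_contract hN Q_ge0 Q_le p0_ge0 p0_le p0_ge lam_le.
have q1_ge0 : 0 <= q1.
  rewrite -lee_fin; apply: le_trans (Q_le i0).
  by apply: esum_ge0 => j /= ji; rewrite lee_fin Q_ge0// eq_sym.
have p_ge0 : 0 <= p by exact: le_trans (p0_le i0).
have N1 : 0 <= N%:R - 1 :> R by rewrite subr_ge0 ler1n ltnW.
have C_ge0 : 0 <= N%:R * q1 + p * (N%:R ^+ 2 / (N%:R - 1)).
  by rewrite addr_ge0 ?mulr_ge0 ?invr_ge0 ?exprn_ge0//.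
pose M := Num.max (`|g eta| + N%:R) (`|h eta| + N%:R).
have bgM : bounded_by M g by move=> x; rewrite le_max bg.
have bhM : bounded_by M h by move=> x; rewrite le_max bh orbT.
apply: (sg_cov_bound (transition_semigroup hFV) (transition_generator hFV)
  (nb := @move_nb F N) C_ge0 _ e0_gt0 _ eta ht bgM bhM).
- move=> M' f x c bf c0 fx fc.
  exact: (fv_generator_local hN Q_ge0 Q_le p0_ge0 p0_le bf c0 fx fc).
- by move=> e K M' f ee0 bf fK; exact: (contract _ _ _ _ ee0 bf fK).
- exact: lipschitz1_nb.
- exact: lipschitz1_nb.
Qed.
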